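(* Consider the maps $$\iota_{aaa}:\mathcal{B}'_{aaa}\to\mathcal{G}_{aaa},\quad T\mapsto (T*\rho_\varepsilon)_\varepsilon+\mathcal{N}_{aaa},$$ $$\sigma_{aaa}:\mathcal{B}_{aaa}\to\mathcal{G}_{aaa},\quad f\mapsto (f)_\varepsilon+\mathcal{N}_{aaa},$$ $$\gamma_{aaa}:\mathcal{B}_{aaa}\to\mathcal{B}'_{aaa},\quad f\mapsto f.$$ Then $\iota_{aaa}$, $\sigma_{aaa}$, $\gamma_{aaa}$ are (well-defined) linear embeddings and the diagram they form is commutative, i.e. $\iota_{aaa}\circ\gamma_{aaa}=\sigma_{aaa}$.
   Context: Notation: $\mathbb{Z}_+=\{0,1,2,\dots\}$, $\mathbb{N}=\{1,2,\dots\}$, $I:=\,]0,1]$, $\mathbb{J}:=[0,+\infty[$. All functions are complex-valued. $\mathcal{C}_b$ is the space of bounded continuous functions on $\mathbb{R}$. A continuous function $g$ on $\mathbb{R}$ is almost automorphic if every real sequence $(s_m)$ has a subsequence $(s_{m_k})_k$ such that $\tilde g(x):=\lim_{k}g(x+s_{m_k})$ exists for every $x\in\mathbb{R}$ and $\lim_k\tilde g(x-s_{m_k})=g(x)$ for every $x\in\mathbb{R}$; $\mathcal{C}_{aa}$ is the space of such functions. $\mathcal{C}_{+,0}$ is the space of $h\in\mathcal{C}_b$ with $\lim_{x\to+\infty}h(x)=0$. $\mathcal{C}_{aaa}$ is the space of $f\in\mathcal{C}_b$ for which there are $g\in\mathcal{C}_{aa}$, $h\in\mathcal{C}_{+,0}$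 with $f=g+h$ on $\mathbb{J}$. $\mathcal{B}_{aaa}$ is the space of smooth functions on $\mathbb{R}$ all of whose derivatives (including order $0$) lie in $\mathcal{C}_{aaa}$; set $|\varphi|_{k,\infty,\mathbb{R}}:=\sum_{j\le k}\|\varphi^{(j)}\|_{L^\infty(\mathbb{R})}$. $\mathcal{D}$ is the space of compactly supported smooth functions on $\mathbb{R}$; $\mathcal{D}_{L^1}(\mathbb{R})$ is the Fréchet space of smooth functions with all derivatives in $L^1(\mathbb{R})$; the space $\mathcal{B}'$ of bounded distributions is the topological dual of $\mathcal{D}_{L^1}(\mathbb{R})$. The space $\mathcal{B}'_{aaa}$ of asymptotically almost automorphic distributions is the space of $T\in\mathcal{B}'$ satisfying one of the following (known to be equivalent) conditions: (i) $T*\varphi\in\mathcal{C}_{aaa}$ for all $\varphi\in\mathcal{D}$; (ii) there are $k\in\mathbb{Z}_+$ and $f_0,\dots,f_k\in\mathcal{C}_{aaa}$ with $T=\sum_{j=0}^k f_j^{(j)}$. $\mathcal{M}_{aaa}$ is the set of nets $(u_\varepsilon)_{\varepsilon\in I}\in(\mathcal{B}_{aaa})^I$ such that $\forall k\in\mathbb{Z}_+\,\exists m\in\mathbb{Z}_+$: $|u_\varepsilon|_{k,\infty,\mathbb{R}}=O(\varepsilon^{-m})$, $\varepsilon\to0$; $\mathcal{N}_{aaa}$ is the set of nets in $(\mathcal{B}_{aaa})^I$ such that $\forall k,m\in\mathbb{Z}_+$: $|u_\varepsilon|_{k,\infty,\mathbb{R}}=O(\varepsilon^{m})$, $\varepsilon\to0$;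 $\mathcal{G}_{aaa}:=\mathcal{M}_{aaa}/\mathcal{N}_{aaa}$. $\rho$ is a fixed function in the Schwartz space $\mathcal{S}$ with $\int_{\mathbb{R}}\rho(x)\,dx=1$ and $\int_{\mathbb{R}}x^k\rho(x)\,dx=0$ for all $k\in\mathbb{N}$, and $\rho_\varepsilon(\cdot):=\frac1\varepsilon\rho(\frac{\cdot}{\varepsilon})$, $\varepsilon>0$. $(f)_\varepsilon$ is the constant net equal to $f$. A linear embedding is an injective linear map. *)

(* Defs.v *)
From HB Require Import structures.
From mathcomp Require Import all_boot all_order all_algebra generic_quotient ring_quotient.
From mathcomp Require Import complex.
From mathcomp Require Import all_classical all_reals all_analysis.
From mathcomp Require Import ess_sup_inf measurable_realfun.
Set Implicit Arguments. Unset Strict Implicit. Unset Printing Implicit Defensive.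
Import Order.TTheory GRing.Theory Num.Theory numFieldNormedType.Exports.
Local Open Scope classical_set_scope.
Local Open Scope ring_scope.
Local Open Scope complex_scope.

Section Complex.
Context {R : realType}.
Local Notation Re := (@complex.Re R).
Local Notation Im := (@complex.Im R).
Implicit Types (f g : R -> R[i]) (a z w : R[i]) (x : R).

(* The norm of [R[i]] is itself valued in [R[i]]; [cmod] is the real modulus. *)
Definition cmod z : R := Re `|z|.

Lemma cmodE z : `|z| = (cmod z)%:C.
Proof. by case: z. Qed.

Lemma cmod_ge0 z : 0 <= cmod z.
Proof. by case: z => a b /=; exact: sqrtr_ge0. Qed.

Lemma cmodM z w : cmod (z * w) = cmod z * cmod w.
Proof. exact: ComplexField.Normc.normcM. Qed.

Lemma cmodD z w : cmod (z + w) <= cmod z + cmod w.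
Proof. by have := ler_normD z w; rewrite !cmodE -rmorphD lecR. Qed.

Lemma cmodN z : cmod (- z) = cmod z.
Proof. by rewrite /cmod normrN. Qed.

Lemma cmod0 : cmod 0 = 0.
Proof. by rewrite /cmod normr0. Qed.

Lemma ler_Re_cmod z : `|Re z| <= cmod z.
Proof.
case: z => a b; rewrite /cmod /= -sqrtr_sqr.
by apply: ler_wsqrtr; rewrite lerDl sqr_ge0.
Qed.

Lemma ler_Im_cmod z : `|Im z| <= cmod z.
Proof.
case: z => a b; rewrite /cmod /= -sqrtr_sqr.
by apply: ler_wsqrtr; rewrite lerDr sqr_ge0.
Qed.

Lemma ReD z w : Re (z + w) = Re z + Re w.
Proof. by case: z w => ? ? [? ?]. Qed.
Lemma ImD z w : Im (z + w) = Im z + Im w.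
Proof. by case: z w => ? ? [? ?]. Qed.
Lemma ReM z w : Re (z * w) =
  Re z * Re w - Im z * Im w.
Proof. by case: z w => ? ? [? ?]. Qed.
Lemma ImM z w : Im (z * w) =
  Re z * Im w + Im z * Re w.
Proof. by case: z w => ? ? [? ?]. Qed.

Lemma continuous_Re : continuous (Re : R[i]^o -> R).
Proof.
move=> z; have F := nbhs_filter (z : R[i]^o).
apply/cvgrPdist_lt => e e0.
have e0' : 0 < e%:C by rewrite ltcR.
apply: (@filterS _ (nbhs z) (nbhs_filter z) _ _ _ (nbhsx_ballx (z : R[i]^o) _ e0')) => w.
rewrite -ball_normE /= cmodE ltcR; apply: le_lt_trans.
have -> : Re z - Re w = Re (z - w) by rewrite ReD; case: (w) => ? ?.
exact: ler_Re_cmod.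
Qed.

Lemma continuous_Im : continuous (Im : R[i]^o -> R).
Proof.
move=> z; have F := nbhs_filter (z : R[i]^o).
apply/cvgrPdist_lt => e e0.
have e0' : 0 < e%:C by rewrite ltcR.
apply: (@filterS _ (nbhs z) (nbhs_filter z) _ _ _ (nbhsx_ballx (z : R[i]^o) _ e0')) => w.
rewrite -ball_normE /= cmodE ltcR; apply: le_lt_trans.
have -> : Im z - Im w = Im (z - w) by rewrite ImD; case: (w) => ? ?.
exact: ler_Im_cmod.
Qed.

(* Derivatives (and, below, integrals) of complex-valued functions of a real
   variable are taken componentwise, so as to rest on the library's [derive1]
   and [\int]. Continuity and limits use the norm topology of [R[i]], carried
   by the regular module [R[i]^o]. *)
Definition cderivable f x :=
  derivable (Re \o f) x 1 /\ derivable (Im \o f) x 1.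

Definition cderive f : R -> R[i] := fun x =>
  derive1 (Re \o f) x +i* derive1 (Im \o f) x.

Definition cderiven n f : R -> R[i] := iter n cderive f.

Definition smooth f := forall n x, cderivable (cderiven n f) x.

Lemma derivable_lin (u v w : R -> R) (p q x : R) :
  derivable u x 1 -> derivable v x 1 -> derivable w x 1 ->
  derivable (p *: u + q *: v + w) x 1 /\
  derive1 (p *: u + q *: v + w) x =
    p * derive1 u x + q * derive1 v x + derive1 w x.
Proof.
move=> /derivableP du /derivableP dv /derivableP dw.
have h := is_deriveD (is_deriveD (is_deriveZ p du) (is_deriveZ q dv)) dw.
by split; [exact: ex_derive|rewrite !derive1E (@derive_val _ _ _ _ _ _ _ h)].
Qed.

Lemma cderivableP a f g x : cderivable f x -> cderivable g x ->
  cderivable (a *: f + g) x /\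
  cderive (a *: f + g) x = a * cderive f x + cderive g x.
Proof.
move=> [f1 f2] [g1 g2].
have Re_E : Re \o (a *: f + g) = Re a *: (Re \o f) + (- Im a) *: (Im \o f)
    + (Re \o g).
  by apply/funext => y; rewrite /= !fctE ReD ReM -mulNr.
have Im_E : Im \o (a *: f + g) = Re a *: (Im \o f) + Im a *: (Re \o f)
    + (Im \o g).
  by apply/funext => y; rewrite /= !fctE ImD ImM.
have [r1 r2] := derivable_lin (Re a) (- Im a) f1 f2 g1.
have [i1 i2] := derivable_lin (Re a) (Im a) f2 f1 g2.
rewrite /cderivable /cderive Re_E Im_E; split; first by split.
rewrite r2 i2 mulNr; case: (a) => ? ?; congr (_ +i* _).
Qed.

Lemma smooth0 : smooth 0.
Proof.
have cd0 : cderive 0 = 0.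
  apply/funext => x; rewrite /cderive.
  have -> : Re \o (0 : R -> R[i]) = cst 0 by [].
  have -> : Im \o (0 : R -> R[i]) = cst 0 by [].
  by rewrite !derive1E !derive_cst.
move=> n x.
have -> : cderiven n 0 = 0 by elim: n => //= n ->.
split; exact: derivable_cst.
Qed.

Lemma cderivenP a f g n : smooth f -> smooth g ->
  cderiven n (a *: f + g) = a *: cderiven n f + cderiven n g.
Proof.
move=> sf sg; elim: n => //= n ->; apply/funext => x.
by rewrite (cderivableP _ (sf n x) (sg n x)).2.
Qed.

Lemma cderiven0 n : cderiven n 0 = 0.
Proof.
have := cderivenP 0 n smooth0 smooth0.
by rewrite !scale0r !add0r => h; have := cderivenP 1 n smooth0 smooth0;
  rewrite !scaler0 addr0 scale1r => /(congr1 (fun u => u - cderiven n 0));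
  rewrite subrr addrK.
Qed.

Lemma smoothP a f g : smooth f -> smooth g -> smooth (a *: f + g).
Proof.
by move=> sf sg n x; rewrite cderivenP//; exact: (cderivableP _ _ _).1.
Qed.

Lemma cderivenS n f : cderiven n (cderive f) = cderiven n.+1 f.
Proof. by rewrite /cderiven -iterSr. Qed.

Lemma smooth_cderive f : smooth f -> smooth (cderive f).
Proof. by move=> sf n x; rewrite cderivenS; exact: sf. Qed.

Lemma cderivable_continuous f : (forall x, cderivable f x) ->
  continuous (Re \o f) /\ continuous (Im \o f).
Proof.
by move=> df; split=> x; apply/differentiable_continuous/derivable1_diffP;
  case: (df x).
Qed.

End Complex.

Section AAA.
Context {R : realType}.
Implicit Types (f g h : R -> R[i]) (a : R[i]) (x : R).

Definition Cb f :=
  continuous (f : R -> R[i]^o) /\ exists M : R, forall x, cmod (f x) <= M.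

Definition almost_automorphic g :=
  continuous (g : R -> R[i]^o) /\
  forall s : nat -> R, exists2 k : nat -> nat, {homo k : m n / (m < n)%N} &
  exists g' : R -> R[i],
    (forall x, (g (x + s (k n)) : R[i]^o) @[n --> \oo] --> (g' x : R[i]^o)) /\
    (forall x, (g' (x - s (k n)) : R[i]^o) @[n --> \oo] --> (g x : R[i]^o)).

Definition Cplus0 h := Cb h /\ (h x : R[i]^o) @[x --> +oo] --> (0 : R[i]^o).

Definition Caaa f := Cb f /\
  exists g h, [/\ almost_automorphic g, Cplus0 h &
    forall x, 0 <= x -> f x = g x + h x].

Definition is_Baaa f := smooth f /\ forall n, Caaa (cderiven n f).

Lemma continuous_lin a f g : continuous (f : R -> R[i]^o) ->
  continuous (g : R -> R[i]^o) -> continuous (a *: f + g : R -> R[i]^o).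
Proof.
by move=> cf cg x; apply: cvgD; [apply: cvgZl_tmp; exact: cf|exact: cg].
Qed.

Lemma Cb_lin a f g : Cb f -> Cb g -> Cb (a *: f + g).
Proof.
move=> [cf [M fM]] [cg [N gN]]; split; first exact: continuous_lin.
exists (cmod a * M + N) => x; rewrite (le_trans (cmodD _ _))// lerD//.
by rewrite cmodM ler_wpM2l ?cmod_ge0.
Qed.

Lemma continuous0 : continuous (0 : R -> R[i]^o).
Proof. by move=> x; exact: cvg_cst. Qed.

Lemma Cb0 : Cb 0.
Proof. by split; [exact: continuous0|exists 0 => x; rewrite cmod0]. Qed.

Lemma homo_ltn_cvgoo (k : nat -> nat) : {homo k : m n / (m < n)%N} ->
  k n @[n --> \oo] --> \oo.
Proof.
move=> hk; have nk n : (n <= k n)%N.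
  by elim: n => // n /leq_ltn_trans; apply; exact: hk.
move=> A [N _ NA]; exists N => // n /= Nn; apply: NA => /=.
exact: leq_trans Nn (nk n).
Qed.

Lemma aa_lin a f g : almost_automorphic f -> almost_automorphic g ->
  almost_automorphic (a *: f + g).
Proof.
move=> [cf af] [cg ag]; split; first exact: continuous_lin.
move=> s; have [k1 hk1 [f' [f1 f2]]] := af s.
have [k2 hk2 [g' [g1 g2]]] := ag (s \o k1).
have ck := homo_ltn_cvgoo hk2.
exists (k1 \o k2) => [m n mn|]; first by apply: hk1; exact: hk2.
exists (a *: f' + g'); split=> x.
- apply: cvgD; [apply: cvgZl_tmp|exact: g1].
  exact: (cvg_comp _ _ ck (f1 x)).
- apply: cvgD; [apply: cvgZl_tmp|exact: g2].
  exact: (cvg_comp _ _ ck (f2 x)).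
Qed.

Lemma aa0 : almost_automorphic 0.
Proof.
split; first exact: continuous0.
by move=> s; exists id => //; exists 0; split=> x; exact: cvg_cst.
Qed.

Lemma Cplus0_lin a f g : Cplus0 f -> Cplus0 g -> Cplus0 (a *: f + g).
Proof.
move=> [cf f0] [cg g0]; split; first exact: Cb_lin.
have h : (a *: f x : R[i]^o) @[x --> +oo] --> a *: (0 : R[i]^o).
  by apply: cvgZl_tmp; exact: f0.
by have := cvgD h g0; rewrite scaler0 addr0; apply.
Qed.

Lemma Cplus00 : Cplus0 0.
Proof. by split; [exact: Cb0|exact: cvg_cst]. Qed.

Lemma Caaa_lin a f g : Caaa f -> Caaa g -> Caaa (a *: f + g).
Proof.
move=> [cf [f1 [f2 [af pf ef]]]] [cg [g1 [g2 [ag pg eg]]]].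
split; first exact: Cb_lin.
exists (a *: f1 + g1), (a *: f2 + g2); split.
- exact: aa_lin.
- exact: Cplus0_lin.
- by move=> x x0; rewrite !fctE ef// eg// scalerDr addrACA.
Qed.

Lemma Caaa0 : Caaa 0.
Proof.
split; first exact: Cb0.
exists 0, 0; split; [exact: aa0|exact: Cplus00|by move=> x _; rewrite addr0].
Qed.

Lemma Baaa_lin a f g : is_Baaa f -> is_Baaa g -> is_Baaa (a *: f + g).
Proof.
move=> [sf cf] [sg cg]; split; first exact: smoothP.
by move=> n; rewrite cderivenP//; exact: Caaa_lin.
Qed.

Lemma Baaa0 : is_Baaa 0.
Proof. by split; [exact: smooth0|move=> n; rewrite cderiven0; exact: Caaa0]. Qed.

End AAA.

Section SubmodType.
Context {K : pzRingType} {V : lmodType K} (P : set V).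

Lemma submod_closed_asbool : P 0 -> (forall a u v, P u -> P v -> P (a *: u + v)) ->
  GRing.subsemimod_closed [pred u | `[< P u >]].
Proof.
move=> P0 Pl; apply: GRing.submod_closed_semi; split; first exact/asboolP.
by move=> a u v /asboolP pu /asboolP pv; apply/asboolP; exact: Pl.
Qed.
End SubmodType.

Section BaaaType.
Variable R : realType.

(* [Baaa R], and likewise [Maaa R], [DL1 R], [Bpaaa R] below, is the subspace
   cut out by the corresponding predicate, as an [lmodType R[i]]. *)
Definition Baaa_pred : {pred R -> R[i]} := fun f => `[< is_Baaa f >].
HB.instance Definition _ := GRing.isSubmodClosed.Build R[i] (R -> R[i]) Baaa_pred
  (submod_closed_asbool Baaa0 Baaa_lin).
Record Baaa := MkBaaa { Baaa_fun :> R -> R[i] ; _ : Baaa_fun \in Baaa_pred }.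
HB.instance Definition _ := [isSub for Baaa_fun].
HB.instance Definition _ := [Choice of Baaa by <:].
HB.instance Definition _ := [SubChoice_isSubLmodule of Baaa by <:].

Lemma BaaaP (f : Baaa) : is_Baaa f.
Proof. by apply/asboolP; exact: (valP f). Qed.
End BaaaType.

Section Norms.
Context {R : realType}.
Local Notation mu := (@lebesgue_measure R).
Implicit Types (f g : R -> R[i]) (a : R[i]) (x : R).

Definition Linf_norm f : \bar R := ('N[mu]_+oo[EFin \o cmod \o f])%E.

(* $|f|_{k,\infty,\mathbb R}$ *)
Definition Winf_norm k f : \bar R := (\sum_(j < k.+1) Linf_norm (cderiven j f))%E.

Lemma Linf_norm_lin a f g :
  (Linf_norm (a *: f + g)%R <= (cmod a)%:E * Linf_norm f + Linf_norm g)%E.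
Proof.
rewrite /Linf_norm unlock /Lnorm; case: ifPn => mu0; last by rewrite mule0 adde0.
rewrite -ess_supZl ?cmod_ge0//; apply: le_trans (ess_supD _ _ _).
apply: le_ess_sup; apply: nearW => x /=.
rewrite -!EFinM -EFinD lee_fin !(ger0_norm (cmod_ge0 _)).
by rewrite -cmodM; exact: cmodD.
Qed.

Lemma Winf_norm_lin k a f g : smooth f -> smooth g ->
  (Winf_norm k (a *: f + g)%R <= (cmod a)%:E * Winf_norm k f + Winf_norm k g)%E.
Proof.
move=> sf sg; rewrite /Winf_norm ge0_sume_distrr; last first.
  by move=> j _; exact: Lnorm_ge0.
rewrite -big_split /=; apply: lee_sum => j _.
by rewrite cderivenP//; exact: Linf_norm_lin.
Qed.

Lemma Linf_norm0 : Linf_norm 0 = 0%E.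
Proof.
rewrite /Linf_norm -(@Lnorm0 _ _ _ mu +oo%E)//; congr Lnorm.
by apply/funext => x; rewrite /= cmod0.
Qed.

Lemma Winf_norm0 k : Winf_norm k 0 = 0%E.
Proof. by rewrite /Winf_norm big1// => j _; rewrite cderiven0 Linf_norm0. Qed.

End Norms.

Section Generalized.
Variable R : realType.

(* The index set ]0, 1] of the nets. *)
Definition epsI := {e : R | 0 < e <= 1}.

(* N(e) = O(p(e)) as e -> 0, for an extended nonnegative N. *)
Definition bigO_eps (N : epsI -> \bar R) (p : R -> R) :=
  exists c eta : R, 0 < eta /\
    forall e : epsI, val e < eta -> (N e <= (c * p (val e))%:E)%E.

Definition moderate (u : epsI -> Baaa R) := forall k, exists m,
  bigO_eps (fun e => Winf_norm k (u e)) (fun e => e ^- m).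

Definition negligible (u : epsI -> Baaa R) := forall k m,
  bigO_eps (fun e => Winf_norm k (u e)) (fun e => e ^+ m).

Lemma epsI_gt0 (e : epsI) : 0 < val e. Proof. by case: e => e /= /andP[]. Qed.
Lemma epsI_le1 (e : epsI) : val e <= 1. Proof. by case: e => e /= /andP[]. Qed.

Lemma bigO_eps_lin k (a : R[i]) (u v : epsI -> Baaa R) (p : R -> R) :
  bigO_eps (fun e => Winf_norm k (u e)) p ->
  bigO_eps (fun e => Winf_norm k (v e)) p ->
  bigO_eps (fun e => Winf_norm k ((a *: u + v) e)) p.
Proof.
move=> [c [eta [eta0 uc]]] [d [zeta [zeta0 vd]]].
exists (cmod a * c + d), (Num.min eta zeta); split.
  by rewrite lt_min eta0.
move=> e; rewrite lt_min => /andP[e1 e2].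
have [[su _] [sv _]] := (BaaaP (u e), BaaaP (v e)).
apply: le_trans (Winf_norm_lin k a su sv) _.
rewrite mulrDl -mulrA EFinD EFinM; apply: leeD; last exact: vd.
by apply: lee_wpmul2l; [rewrite lee_fin cmod_ge0|exact: uc].
Qed.

Lemma le_bigO_eps (N : epsI -> \bar R) (p q : R -> R) :
  (forall e : epsI, 0 <= p (val e) <= q (val e)) -> bigO_eps N p -> bigO_eps N q.
Proof.
move=> pq [c [eta [eta0 Nc]]]; exists `|c|, eta; split=> // e /Nc/le_trans; apply.
rewrite lee_fin; have /andP[p0 pqe] := pq e.
by rewrite (le_trans (ler_wpM2r p0 (ler_norm c)))// ler_wpM2l.
Qed.

Lemma moderate_lin a (u v : epsI -> Baaa R) : moderate u -> moderate v -> moderate (a *: u + v).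
Proof.
have h (m n : nat) : (m <= n)%N -> forall e : epsI, 0 <= (val e) ^- m <= (val e) ^- n.
  move=> mn e; rewrite invr_ge0 exprn_ge0 ?(ltW (epsI_gt0 e))//=.
  rewrite lef_pV2 ?posrE ?exprn_gt0 ?epsI_gt0//.
  by rewrite ler_wiXn2l ?epsI_le1// (ltW (epsI_gt0 e)).
move=> mu mv k; have [[m um] [n vn]] := (mu k, mv k).
exists (maxn m n); apply: bigO_eps_lin.
- by apply: le_bigO_eps um; apply: h; exact: leq_maxl.
- by apply: le_bigO_eps vn; apply: h; exact: leq_maxr.
Qed.

Lemma negligible_lin a (u v : epsI -> Baaa R) : negligible u -> negligible v -> negligible (a *: u + v).
Proof. by move=> nu nv k m; apply: bigO_eps_lin; [exact: nu|exact: nv]. Qed.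

Lemma bigO_eps0 k (p : R -> R) :
  bigO_eps (fun e => Winf_norm k ((0 : epsI -> Baaa R) e)) p.
Proof. by exists 0, 1; split=> // e _; rewrite mul0r Winf_norm0. Qed.

Lemma negligible0 : negligible 0.
Proof. by move=> k m; exact: bigO_eps0. Qed.

Lemma moderate0 : moderate 0.
Proof. by move=> k; exists 0%N; exact: bigO_eps0. Qed.

(* Hence the null nets may be taken inside the type of moderate nets, as
   [Naaa_pred] does. *)
Lemma negligible_moderate (u : epsI -> Baaa R) : negligible u -> moderate u.
Proof.
move=> nu k; exists 0%N; have [c [eta [eta0 h]]] := nu k 0%N.
by exists c, eta; split=> // e /h; rewrite expr0 invr1.
Qed.

Definition Maaa_pred : {pred epsI -> Baaa R} := fun u => `[< moderate u >].
HB.instance Definition _ :=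
  GRing.isSubmodClosed.Build R[i] (epsI -> Baaa R) Maaa_pred
    (submod_closed_asbool moderate0 moderate_lin).
Record Maaa := MkMaaa { Maaa_net :> epsI -> Baaa R ; _ : Maaa_net \in Maaa_pred }.
HB.instance Definition _ := [isSub for Maaa_net].
HB.instance Definition _ := [Choice of Maaa by <:].
HB.instance Definition _ := [SubChoice_isSubLmodule of Maaa by <:].

Lemma MaaaP (u : Maaa) : moderate u.
Proof. by apply/asboolP; exact: (valP u). Qed.

Lemma negligibleM_lin a (u v : Maaa) : negligible u -> negligible v ->
  negligible (a *: u + v : Maaa).
Proof. exact: negligible_lin. Qed.

Lemma negligibleM0 : negligible (0 : Maaa).
Proof. exact: negligible0. Qed.

Definition Naaa_pred : {pred Maaa} := fun u => `[< negligible u >].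
Fact Naaa_submod_closed : GRing.subsemimod_closed Naaa_pred.
Proof.
apply: (submod_closed_asbool (V := Maaa)) => [|a u v].
  exact: negligibleM0.
exact: negligibleM_lin.
Qed.
HB.instance Definition _ :=
  GRing.isSubmodClosed.Build R[i] Maaa Naaa_pred Naaa_submod_closed.

Definition Gaaa := Quotient.quot Naaa_pred.
HB.instance Definition _ := GRing.Zmodule.on Gaaa.

Definition Gaaa_class (u : Maaa) : Gaaa := (\pi_(Quotient.quot Naaa_pred) u)%qT.

Lemma Gaaa_classP (u v : Maaa) : Gaaa_class u = Gaaa_class v <-> negligible (u - v : Maaa).
Proof.
rewrite /Gaaa_class; split=> [/eqP|nuv].
  by rewrite -Quotient.idealrBE => /asboolP.
by apply/eqP; rewrite -Quotient.idealrBE; apply/asboolP.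
Qed.

Lemma Gaaa_class_surj (U : Gaaa) : exists u, U = Gaaa_class u.
Proof. by exists (repr (U : Quotient.quot Naaa_pred)); rewrite /Gaaa_class reprK. Qed.

Lemma Gaaa_classD : {morph Gaaa_class : u v / u + v}.
Proof. by move=> u v; rewrite /Gaaa_class; exact: Quotient.pi_add. Qed.

(* The quotient of an additive group by a subgroup comes from [ring_quotient];
   the scaling, absent there, is the one induced on classes. *)
Definition Gaaa_scale (a : R[i]) (U : Gaaa) : Gaaa :=
  Gaaa_class (a *: repr (U : Quotient.quot Naaa_pred)).

Lemma Gaaa_classZ a (u : Maaa) : Gaaa_class (a *: u) = Gaaa_scale a (Gaaa_class u).
Proof.
apply/Gaaa_classP.
have /Gaaa_classP n : Gaaa_class u =
    Gaaa_class (repr (Gaaa_class u : Quotient.quot Naaa_pred)).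
  by rewrite {2}/Gaaa_class reprK.
rewrite -scalerBr -[_ *: _]addr0; apply: negligibleM_lin => //.
exact: negligibleM0.
Qed.

Fact Gaaa_scalerA a b U : Gaaa_scale a (Gaaa_scale b U) = Gaaa_scale (a * b) U.
Proof.
by have [u ->] := Gaaa_class_surj U; rewrite -!Gaaa_classZ scalerA.
Qed.
Fact Gaaa_scale1r : left_id 1 Gaaa_scale.
Proof.
by move=> U; have [u ->] := Gaaa_class_surj U; rewrite -!Gaaa_classZ scale1r.
Qed.
Fact Gaaa_scalerDr : right_distributive Gaaa_scale +%R.
Proof.
move=> a U V; have [u ->] := Gaaa_class_surj U.
have [v ->] := Gaaa_class_surj V.
by rewrite -Gaaa_classD -!Gaaa_classZ scalerDr Gaaa_classD.
Qed.
Fact Gaaa_scalerDl U : {morph Gaaa_scale^~ U : a b / a + b}.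
Proof.
move=> a b; have [u ->] := Gaaa_class_surj U.
by rewrite -!Gaaa_classZ scalerDl Gaaa_classD.
Qed.
HB.instance Definition _ := GRing.Zmodule_isLmodule.Build R[i] Gaaa
  Gaaa_scalerA Gaaa_scale1r Gaaa_scalerDr Gaaa_scalerDl.

Lemma Gaaa_class_is_linear : linear Gaaa_class.
Proof. by move=> a u v; rewrite Gaaa_classD Gaaa_classZ. Qed.
HB.instance Definition _ :=
  GRing.isLinear.Build R[i] Maaa Gaaa _ Gaaa_class Gaaa_class_is_linear.

End Generalized.

Section Integral.
Context {R : realType}.
Local Notation mu := (@lebesgue_measure R).
Local Notation Re := (@complex.Re R).
Local Notation Im := (@complex.Im R).
Implicit Types (f g phi : R -> R[i]) (a : R[i]).

Definition cintegrable f :=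
  mu.-integrable setT (EFin \o Re \o f) /\ mu.-integrable setT (EFin \o Im \o f).

Definition cintegral f : R[i] :=
  (\int[mu]_x Re (f x)) +i* (\int[mu]_x Im (f x)).

Lemma integrable_lin (u v w : R -> R) (p q : R) :
  mu.-integrable setT (EFin \o u) -> mu.-integrable setT (EFin \o v) ->
  mu.-integrable setT (EFin \o w) ->
  mu.-integrable setT (EFin \o (fun x => p * u x + q * v x + w x)) /\
  \int[mu]_x (p * u x + q * v x + w x) =
  p * (\int[mu]_x u x) + q * (\int[mu]_x v x) + \int[mu]_x w x.
Proof.
move=> iu iv iw.
have ipu : mu.-integrable setT (EFin \o (fun x => p * u x)).
  exact: (integrableZl measurableT p iu).
have iqv : mu.-integrable setT (EFin \o (fun x => q * v x)).
  exact: (integrableZl measurableT q iv).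
have ipq : mu.-integrable setT (EFin \o (fun x => p * u x + q * v x)).
  exact: (integrableD measurableT ipu iqv).
split; first exact: (integrableD measurableT ipq iw).
by rewrite RintegralD// RintegralD// !RintegralZl.
Qed.

Lemma cintegral_lin a f g : cintegrable f -> cintegrable g ->
  cintegrable (a *: f + g) /\
  cintegral (a *: f + g) = a * cintegral f + cintegral g.
Proof.
move=> [f1 f2] [g1 g2].
have ReE : Re \o (a *: f + g) =
    fun x => Re a * Re (f x) + (- Im a) * Im (f x) + Re (g x).
  by apply/funext => y; rewrite /= ReD ReM mulNr.
have ImE : Im \o (a *: f + g) =
    fun x => Re a * Im (f x) + Im a * Re (f x) + Im (g x).
  by apply/funext => y; rewrite /= ImD ImM.
have [r1 r2] := integrable_lin (Re a) (- Im a) f1 f2 g1.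
have [i1 i2] := integrable_lin (Re a) (Im a) f2 f1 g2.
split; first by split; [move: r1; rewrite -ReE|move: i1; rewrite -ImE].
rewrite /cintegral.
rewrite (_ : (fun x => Re _) = Re \o (a *: f + g))// ReE.
rewrite (_ : (fun x => Im ((_ + _) x)) = Im \o (a *: f + g))// ImE.
by rewrite r2 i2 mulNr; case: (a) => ? ?.
Qed.

Lemma cintegrable0 : cintegrable 0.
Proof. by split; exact: integrable0. Qed.

Lemma cintegral0 : cintegral 0 = 0.
Proof.
have [_] := cintegral_lin 0 cintegrable0 cintegrable0.
by rewrite scale0r addr0 mul0r add0r => _; rewrite /cintegral /= !Rintegral_cst//
  !mul0r.
Qed.

Lemma continuous_mmeasurable (h : R -> R) : continuous h ->
  measurable_fun [set: measurableTypeR R] (h : measurableTypeR R -> R).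
Proof. exact: continuous_measurable_fun. Qed.

Lemma continuous_cmeasurable f : continuous (f : R -> R[i]^o) ->
  measurable_fun [set: measurableTypeR R] (Re \o f : measurableTypeR R -> R) /\
  measurable_fun [set: measurableTypeR R] (Im \o f : measurableTypeR R -> R).
Proof.
move=> cf; split; apply: continuous_mmeasurable => x;
  apply: continuous_comp (cf x) _; [exact: continuous_Re|exact: continuous_Im].
Qed.

Lemma Cb_cintegrable f g : Cb f -> cintegrable g ->
  cintegrable (fun x => f x * g x).
Proof.
move=> [cf [M fM]] [g1 g2]; have [mf1 mf2] := continuous_cmeasurable cf.
have b1 : [bounded ((Re \o f : measurableTypeR R -> R) x) | x in [set: measurableTypeR R]].
  exists M; split; first exact: num_real.
  move=> N MN x _ /=; apply: le_trans (ltW MN).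
  exact: le_trans (ler_Re_cmod _) (fM x).
have b2 : [bounded ((Im \o f : measurableTypeR R -> R) x) | x in [set: measurableTypeR R]].
  exists M; split; first exact: num_real.
  move=> N MN x _ /=; apply: le_trans (ltW MN).
  exact: le_trans (ler_Im_cmod _) (fM x).
split.
- have := integrableB measurableT (integrableMr measurableT mf1 b1 g1)
    (integrableMr measurableT mf2 b2 g2).
  apply: etrans; congr (_.-integrable _ _); apply/funext => x /=.
  by rewrite -!EFinM -EFinB ReM.
- have := integrableD measurableT (integrableMr measurableT mf1 b1 g2)
    (integrableMr measurableT mf2 b2 g1).
  apply: etrans; congr (_.-integrable _ _); apply/funext => x /=.
  by rewrite -!EFinM -EFinD ImM.
Qed.

Lemma integrable_oneDsqrV : mu.-integrable setT (EFin \o (fun x : R => (oneDsqr x)^-1)).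
Proof.
have mV := continuous_mmeasurable (@continuous_oneDsqrV R).
apply/integrableP; split; first exact/measurable_EFinP.
under eq_integral.
  move=> x _; rewrite /= ger0_norm; last by rewrite invr_ge0 (le_trans ler01 (oneDsqr_ge1 _)).
  over.
rewrite ge0_symfun_integralT.
- rewrite (_ : [set x | 0 <= x] = `[0, +oo[%classic); last first.
    by apply/seteqP; split => x /=; rewrite in_itv/= andbT.
  by rewrite integral0y_oneDsqr -EFinM ltry.
- by move=> x; rewrite invr_ge0 (le_trans ler01 (oneDsqr_ge1 _)).
- exact: continuous_oneDsqrV.
- by move=> x; rewrite /= /oneDsqr sqrrN.
Qed.

Lemma cintegrable_decay f (M : R) : (forall x, cderivable f x) ->
  (forall x, (1 + x ^+ 2) * cmod (f x) <= M) -> cintegrable f.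
Proof.
move=> df fM; have [c1 c2] := cderivable_continuous df.
have iM := integrableZl measurableT M integrable_oneDsqrV.
have bnd x : cmod (f x) <= `|M * (oneDsqr x)^-1|.
  apply: le_trans (ler_norm _).
  by rewrite ler_pdivlMr ?(lt_le_trans ltr01 (oneDsqr_ge1 _))// mulrC; exact: fM.
split; apply: (le_integrable measurableT _ _ iM).
- by apply/measurable_EFinP; exact: continuous_mmeasurable.
- by move=> x _; rewrite /= lee_fin; exact: le_trans (ler_Re_cmod _) (bnd x).
- by apply/measurable_EFinP; exact: continuous_mmeasurable.
- by move=> x _; rewrite /= lee_fin; exact: le_trans (ler_Im_cmod _) (bnd x).
Qed.

Definition is_DL1 phi := smooth phi /\ forall n, cintegrable (cderiven n phi).

Lemma DL1_0 : is_DL1 0.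
Proof.
by split; [exact: smooth0|move=> n; rewrite cderiven0; exact: cintegrable0].
Qed.

Lemma DL1_lin a f g : is_DL1 f -> is_DL1 g -> is_DL1 (a *: f + g).
Proof.
move=> [sf jf] [sg jg]; split; first exact: smoothP.
by move=> n; rewrite cderivenP//; apply: (cintegral_lin _ _ _).1.
Qed.

Definition schwartz f := smooth f /\
  forall n k, exists M : R, forall x, `|x| ^+ n * cmod (cderiven k f x) <= M.

Lemma schwartz_DL1 f : schwartz f -> is_DL1 f.
Proof.
move=> [sf bf]; split=> // n; have [[M fM] [N fN]] := (bf 0%N n, bf 2%N n).
apply: (@cintegrable_decay _ (M + N)) => [x|x]; first exact: sf.
rewrite mulrDl lerD//.
  by have := fM x; rewrite expr0.
by have := fN x; rewrite -normrX (ger0_norm (sqr_ge0 _)).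
Qed.

Lemma cderivable_affine f (p q : R) : (forall x, cderivable f x) ->
  (forall x, cderivable (fun y => f (p * y + q)) x) /\
  cderive (fun y => f (p * y + q)) = fun y => p%:C * cderive f (p * y + q).
Proof.
move=> df.
have da (x : R) : is_derive x (1:R) (fun y : R => p * y + q : R) p.
  have := is_deriveD (is_deriveZ p (is_derive_id x 1)) (is_derive_cst q x 1).
  by rewrite addr0 /GRing.scale/= mulr1.
have dc (u : R -> R) (x : R) : (forall y, derivable u y 1) ->
    derivable (fun y => u (p * y + q)) x 1 /\
    derive1 (fun y => u (p * y + q)) x = p * derive1 u (p * x + q).
  move=> du; have da1 : derivable (fun y : R => p * y + q) x 1 by exact: ex_derive.
  split.
    apply/derivable1_diffP.
    apply: (@differentiable_comp _ _ _ _ (fun y : R => p * y + q) u).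
      exact/derivable1_diffP.
    exact/derivable1_diffP.
  rewrite (@derive1_comp _ (fun y : R => p * y + q) u)// mulrC; congr (_ * _).
  by rewrite derive1E derive_val.
have d1 y : derivable (Re \o f) y 1 by case: (df y).
have d2 y : derivable (Im \o f) y 1 by case: (df y).
split=> [x|].
  by split; [exact: (dc _ x d1).1|exact: (dc _ x d2).1].
apply/funext => x; rewrite /cderive.
rewrite (dc _ x d1).2 (dc _ x d2).2; set u := derive1 _ _; set v := derive1 _ _.
by apply/eqP; rewrite eq_complex /= !mul0r subr0 addr0 !eqxx.
Qed.

Lemma cderiven_affine f (p q : R) n : smooth f ->
  (forall x, cderivable (cderiven n (fun y => f (p * y + q))) x) /\
  cderiven n (fun y => f (p * y + q)) =
  fun y => (p ^+ n)%:C * cderiven n f (p * y + q).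
Proof.
move=> sf.
have sc (c : R[i]) g : (forall x, cderivable g x) ->
    (forall x, cderivable (fun y => c * g y) x) /\
    cderive (fun y => c * g y) = fun y => c * cderive g y.
  move=> dg; have d0 x : cderivable (0 : R -> R[i]) x by exact: (smooth0 0%N).
  have e : (fun y => c * g y) = c *: g + 0 by rewrite addr0.
  have e0 : cderive (0 : R -> R[i]) = 0 by exact: (cderiven0 1%N).
  split=> [x|]; first by rewrite e; exact: (cderivableP c (dg x) (d0 x)).1.
  by apply/funext => x; rewrite e (cderivableP c (dg x) (d0 x)).2 e0 addr0.
have key n' : cderiven n' (fun y => f (p * y + q)) =
    fun y => (p ^+ n')%:C * cderiven n' f (p * y + q).
  elim: n' => [|n' IH].
    by apply/funext => y /=; rewrite expr0 mul1r.
  have [dg eg] := cderivable_affine p q (sf n').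
  rewrite [LHS]/= IH (sc _ _ dg).2 eg; apply/funext => y /=.
  by rewrite mulrA -rmorphM/= -exprSr.
split=> [x|]; last exact: key.
have [dg eg] := cderivable_affine p q (sf n).
by rewrite key; exact: (sc _ _ dg).1.
Qed.

Lemma schwartz_affine f (p q : R) : p != 0 -> schwartz f ->
  schwartz (fun y => f (p * y + q)).
Proof.
move=> p0 [sf bf]; split=> [n x|n k]; first exact: (cderiven_affine p q n sf).1.
rewrite (cderiven_affine p q k sf).2.
have [[M fM] [N fN]] := (bf n k, bf 0%N k).
exists ((2 / `|p|) ^+ n * (`|p| ^+ k) * (M + `|q| ^+ n * N)) => y.
have -> : cmod ((p ^+ k)%:C * cderiven k f (p * y + q)) =
    `|p| ^+ k * cmod (cderiven k f (p * y + q)).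
  by rewrite cmodM; congr (_ * _); rewrite /cmod /= expr0n/= addr0 sqrtr_sqr normrX.
have pgt0 : 0 < `|p| by rewrite normr_gt0.
set z := p * y + q; set G := cmod _.
have G0 : 0 <= G by exact: cmod_ge0.
have hy : `|y| <= (`|z| + `|q|) / `|p|.
  rewrite ler_pdivlMr// -normrM mulrC (_ : p * y = z - q) ?ler_normB//.
  by rewrite /z addrK.
have hz : `|y| ^+ n <= (2 / `|p|) ^+ n * (`|z| ^+ n + `|q| ^+ n).
  have h1 : `|y| <= 2 / `|p| * Num.max `|z| `|q|.
    apply: (le_trans hy); rewrite mulrAC ler_pM2r ?invr_gt0//.
    by rewrite mulr2n mulrDl !mul1r lerD// le_max lexx ?orbT.
  have h2 : `|y| ^+ n <= (2 / `|p| * Num.max `|z| `|q|) ^+ n.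
    by apply: lerXn2r => //; rewrite nnegrE// (le_trans _ h1).
  apply: (le_trans h2); rewrite exprMn ler_wpM2l ?exprn_ge0 ?divr_ge0//.
  by have [_|_] := leP `|z| `|q|; rewrite ?lerDr ?lerDl exprn_ge0.
apply: (@le_trans _ _ ((2 / `|p|) ^+ n * (`|z| ^+ n + `|q| ^+ n) * (`|p| ^+ k * G))).
  by rewrite ler_wpM2r// mulr_ge0// exprn_ge0.
rewrite mulrACA [X in _ * X](_ : _ = `|z| ^+ n * G + `|q| ^+ n * G); last first.
  by rewrite mulrDl.
rewrite ler_wpM2l ?mulr_ge0 ?exprn_ge0 ?divr_ge0//.
apply: lerD; first exact: fM.
by rewrite ler_wpM2l ?exprn_ge0//; have := fN z; rewrite expr0 mul1r.
Qed.

Lemma schwartzZ a f : schwartz f -> schwartz (fun x => a * f x).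
Proof.
move=> [sf bf].
have e : (fun x => a * f x) = a *: f + 0 by rewrite addr0.
split=> [|n k]; first by rewrite e; apply: smoothP => //; exact: smooth0.
have [M fM] := bf n k; exists (cmod a * M) => x.
rewrite e cderivenP//; last exact: smooth0.
rewrite cderiven0 addr0 cmodM mulrCA ler_wpM2l ?cmod_ge0//.
Qed.

Definition mollifier (rho : R -> R[i]) (e : R) : R -> R[i] :=
  fun x => (e^-1)%:C * rho (x / e).

Lemma schwartz_mollifier (rho : R -> R[i]) (e : R) : 0 < e -> schwartz rho ->
  schwartz (mollifier rho e).
Proof.
move=> e0 srho; apply: schwartzZ.
have /(schwartz_affine 0) := srho.
move=> /(_ e^-1); rewrite invr_neq0 ?gt_eqF// => /(_ isT).
by congr schwartz; apply/funext => x; rewrite addr0 mulrC.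
Qed.

End Integral.

Section Distributions.
Variable R : realType.
Local Notation mu := (@lebesgue_measure R).
Implicit Types (a : R[i]).

Definition DL1_pred : {pred R -> R[i]} := fun phi => `[< is_DL1 phi >].
HB.instance Definition _ := GRing.isSubmodClosed.Build R[i] (R -> R[i]) DL1_pred
  (submod_closed_asbool DL1_0 DL1_lin).
Record DL1 := MkDL1 { DL1_fun :> R -> R[i] ; _ : DL1_fun \in DL1_pred }.
HB.instance Definition _ := [isSub for DL1_fun].
HB.instance Definition _ := [Choice of DL1 by <:].
HB.instance Definition _ := [SubChoice_isSubLmodule of DL1 by <:].

Lemma DL1P (phi : DL1) : is_DL1 phi.
Proof. by apply/asboolP; exact: (valP phi). Qed.

Fact DL1_deriv_subproof (phi : DL1) : cderive phi \in DL1_pred.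
Proof.
apply/asboolP; have [sphi iphi] := DL1P phi; split; first exact: smooth_cderive.
by move=> n; rewrite cderivenS.
Qed.
Definition DL1_deriv (phi : DL1) : DL1 := MkDL1 (DL1_deriv_subproof phi).

Lemma DL1_deriv_lin a (phi psi : DL1) :
  DL1_deriv (a *: phi + psi) = a *: DL1_deriv phi + DL1_deriv psi.
Proof.
apply/val_inj; have [[sphi _] [spsi _]] := (DL1P phi, DL1P psi).
exact: (cderivenP a 1 sphi spsi).
Qed.

Definition W1_norm k (phi : DL1) : \bar R :=
  (\sum_(j < k.+1) 'N[mu]_1[EFin \o cmod \o cderiven j phi])%E.

Implicit Types (T S : DL1 -> R[i]).

(* Continuity for the locally convex topology defined by the increasing family
   of seminorms [W1_norm k]. *)
Definition DL1_continuous T := forall (phi0 : DL1) (e : R), 0 < e ->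
  exists k (d : R), 0 < d /\ forall phi : DL1,
    (W1_norm k (phi - phi0)%R < d%:E)%E -> cmod (T phi - T phi0) < e.

Definition bounded_distribution T := linear T /\ DL1_continuous T.

(* The regular distribution defined by f. *)
Definition dist_of (f : R -> R[i]) : DL1 -> R[i] :=
  fun phi => cintegral (fun x => f x * phi x).

Definition dist_deriv T : DL1 -> R[i] := fun phi => - T (DL1_deriv phi).

(* Of the two known equivalent definitions of asymptotically almost automorphic
   distributions (regularizations T * phi in Caaa for all test functions phi, or
   finite sum of distributional derivatives of functions of Caaa), the second. *)
Definition is_Bpaaa T := bounded_distribution T /\
  exists k (f : nat -> R -> R[i]), (forall j, (j <= k)%N -> Caaa (f j)) /\
    T = \sum_(j < k.+1) iter j dist_deriv (dist_of (f j)).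

Lemma dist_of_lin a (f g : R -> R[i]) : Cb f -> Cb g ->
  dist_of (a *: f + g) = a *: dist_of f + dist_of g.
Proof.
move=> bf bg; apply/funext => phi.
have ip : cintegrable phi by have [_ /(_ 0%N)] := DL1P phi.
apply: etrans (cintegral_lin a (Cb_cintegrable bf ip) (Cb_cintegrable bg ip)).2.
by rewrite /dist_of; congr cintegral; apply/funext => x; rewrite !fctE mulrDl scalerAl.
Qed.

Lemma dist_of0 : dist_of 0 = 0.
Proof.
apply/funext => phi; rewrite /dist_of -[RHS]cintegral0; congr cintegral.
by apply/funext => x; rewrite mul0r.
Qed.

Lemma iter_dist_deriv_lin j a T S : iter j dist_deriv (a *: T + S) =
  a *: iter j dist_deriv T + iter j dist_deriv S.
Proof.
elim: j => //= j ->; apply/funext => phi.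
by rewrite /dist_deriv !fctE opprD scalerN.
Qed.

Lemma iter_dist_deriv0 j : iter j dist_deriv 0 = 0.
Proof.
by elim: j => //= j ->; apply/funext => phi; rewrite /dist_deriv oppr0.
Qed.

Lemma bounded_distribution_lin a T S : bounded_distribution T ->
  bounded_distribution S -> bounded_distribution (a *: T + S).
Proof.
move=> [lT cT] [lS cS]; split=> [b phi psi|phi0 e e0].
  rewrite !fctE lT lS !scalerDr !scalerA (mulrC a b) -!addrA; congr (_ + _).
  by rewrite addrCA.
have ca0 : 0 < cmod a + 1 by rewrite ltr_wpDl ?cmod_ge0.
have eT0 : 0 < e / 2 / (cmod a + 1) by rewrite !divr_gt0.
have eS0 : 0 < e / 2 by rewrite divr_gt0.
have [k [d [d0 hT]]] := cT phi0 _ eT0.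
have [l [d' [d0' hS]]] := cS phi0 _ eS0.
have mono m n phi : (m <= n)%N -> (W1_norm m phi <= W1_norm n phi)%E.
  move=> mn; rewrite /W1_norm -!(big_mkord xpredT
    (fun j => ('N[mu]_1[EFin \o cmod \o cderiven j phi])%E)).
  rewrite [leRHS](@big_cat_nat _ _ _ m.+1)//= leeDl// sume_ge0// => j _.
  exact: Lnorm_ge0.
exists (maxn k l), (Num.min d d'); split; first by rewrite lt_min d0.
move=> phi; rewrite EFin_min lt_min => /andP[h1 h2].
have {}h1 := hT phi (le_lt_trans (mono _ _ _ (leq_maxl k l)) h1).
have {}h2 := hS phi (le_lt_trans (mono _ _ _ (leq_maxr k l)) h2).
have -> : (a *: T + S) phi - (a *: T + S) phi0 =
    a * (T phi - T phi0) + (S phi - S phi0).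
  by rewrite !fctE /GRing.scale/= mulrBr opprD addrACA.
rewrite (le_lt_trans (cmodD _ _))// cmodM (splitr e) ler_ltD//.
rewrite (@le_trans _ _ ((cmod a + 1) * (e / 2 / (cmod a + 1))))//.
  by apply: ler_pM; rewrite ?cmod_ge0 ?lerDl// ltW.
by rewrite mulrC divfK ?gt_eqF.
Qed.

Lemma bounded_distribution0 : bounded_distribution 0.
Proof.
split=> [b phi psi|phi0 e e0]; first by rewrite scaler0 addr0.
by exists 0%N, 1; split=> // phi _; rewrite subrr cmod0.
Qed.

Lemma Bpaaa_lin a T S : is_Bpaaa T -> is_Bpaaa S -> is_Bpaaa (a *: T + S).
Proof.
move=> [bT [k [f [cf eT]]]] [bS [l [g [cg eS]]]].
split; first exact: bounded_distribution_lin.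
pose cut n (h : nat -> R -> R[i]) j := if (j <= n)%N then h j else 0.
have ccut n (h : nat -> R -> R[i]) j : (forall j, (j <= n)%N -> Caaa (h j)) -> Caaa (cut n h j).
  by move=> hh; rewrite /cut; case: ifPn => [/hh//|_]; exact: Caaa0.
have ecut n m (h : nat -> R -> R[i]) : (n <= m)%N ->
    \sum_(j < n.+1) iter j dist_deriv (dist_of (h j)) =
    \sum_(j < m.+1) iter j dist_deriv (dist_of (cut n h j)).
  move=> nm; rewrite (big_ord_widen m.+1 (fun j => iter j dist_deriv (dist_of (h j))))//.
  rewrite [RHS](bigID (fun j : 'I_m.+1 => (j < n.+1)%N))/= [X in _ + X]big1 ?addr0.
    by apply: eq_bigr => j; rewrite ltnS /cut => ->.
  by move=> j; rewrite ltnS /cut => /negbTE ->; rewrite dist_of0 iter_dist_deriv0.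
exists (maxn k l), (fun j => a *: cut k f j + cut l g j); split.
  by move=> j _; apply: Caaa_lin; exact: ccut.
rewrite {1}eT {1}eS (ecut _ _ _ (leq_maxl k l)) (ecut _ _ _ (leq_maxr k l)).
rewrite scaler_sumr -big_split/=; apply: eq_bigr => j _.
have [bf _] := ccut k f j cf; have [bg _] := ccut l g j cg.
by rewrite dist_of_lin// iter_dist_deriv_lin.
Qed.

Lemma Bpaaa0 : is_Bpaaa 0.
Proof.
split; first exact: bounded_distribution0.
exists 0%N, (fun=> 0); split=> [j _|]; first exact: Caaa0.
by rewrite big_ord1/= dist_of0.
Qed.

Definition Bpaaa_pred : {pred DL1 -> R[i]} := fun T => `[< is_Bpaaa T >].
HB.instance Definition _ := GRing.isSubmodClosed.Build R[i] (DL1 -> R[i]) Bpaaa_pred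
  (submod_closed_asbool Bpaaa0 Bpaaa_lin).
Record Bpaaa := MkBpaaa { Bpaaa_fun :> DL1 -> R[i] ; _ : Bpaaa_fun \in Bpaaa_pred }.
HB.instance Definition _ := [isSub for Bpaaa_fun].
HB.instance Definition _ := [Choice of Bpaaa by <:].
HB.instance Definition _ := [SubChoice_isSubLmodule of Bpaaa by <:].

Lemma BpaaaP (T : Bpaaa) : is_Bpaaa T.
Proof. by apply/asboolP; exact: (valP T). Qed.

Fact DL1_reflect_subproof (phi : R -> R[i]) (x : R) : schwartz phi ->
  (fun y => phi (x - y)) \in DL1_pred.
Proof.
move=> sphi; apply/asboolP/schwartz_DL1.
have -> : (fun y => phi (x - y)) = fun y => phi (-1 * y + x).
  by apply/funext => y; rewrite mulN1r addrC.
by apply: schwartz_affine => //; rewrite oppr_eq0 oner_eq0.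
Qed.
Definition DL1_reflect phi (sphi : schwartz phi) (x : R) : DL1 :=
  MkDL1 (DL1_reflect_subproof x sphi).

(* $(T * \varphi)(x) = \langle T, \varphi(x - \cdot)\rangle$ *)
Definition dist_conv T phi (sphi : schwartz phi) : R -> R[i] :=
  fun x => T (DL1_reflect sphi x).

End Distributions.

(* Main.v *)
(* Writing [T = sum_j f_j^(j)] with [f_j] in [Caaa], one has
   [T * rho_eps = sum_j f_j * rho_eps^(j)], and [f * phi] lies in [Caaa] for [f] in
   [Caaa] and [phi] Schwartz, by dominated convergence on the almost automorphic and
   on the vanishing part of [f]; a change of variables bounds its [n]-th derivative
   by [eps^-(j+n)].  For [f] in [Baaa], derivatives pass to [f], and Taylor's formula
   together with the vanishing moments of [rho] makes [f * rho_eps - f] negligible.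
   The constant embedding is injective since a continuous function with null
   essential supremum is zero, hence so is [f |-> f] by commutativity.  If
   [T * rho_eps] is negligible, its integral against [phi] in [DL1] tends to 0,
   whereas integration by parts and [f_j * rho_eps --> f_j] show that it tends to
   [T phi]. *)
Require Import Defs.
From HB Require Import structures.
From mathcomp Require Import all_boot all_order all_algebra complex.
From mathcomp Require Import all_classical all_reals all_analysis.
From mathcomp Require Import ess_sup_inf measurable_realfun ring lra.
Import Order.TTheory GRing.Theory Num.Theory numFieldNormedType.Exports.
Local Open Scope classical_set_scope.
Local Open Scope ring_scope.
Local Open Scope complex_scope.

(** * Integration on the real line *)

(** Three constraints shape the estimates. A function of [DL1] is only given as integrable together
    with its derivatives, so boundary terms at infinity cannot be read off from decay; integration
    by parts therefore rests on showing, from integrability alone, that a derivative has zero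
    integral. Dominated convergence concerns sequences, so limits in eps are taken along
    [1 / (n + 1)] and limits at [+oo] are tested on sequences. Complex integrals are componentwise,
    so bounding the two components separately puts a factor 2 in the estimates; it is harmless,
    since only powers of eps matter. All moments of [rho] have to vanish because negligibility asks
    for every power of eps: the Taylor order is chosen after the exponent [m], and all intermediate
    terms must cancel. *)

Section RealIntegrals.
Set Implicit Arguments. Unset Strict Implicit.
Context {R : realType}.
Local Notation mu := (@lebesgue_measure R).
Local Notation RM := (measurableTypeR R).
Implicit Types (f F : R -> R).

Definition affine (p q : R) : RM -> RM := fun x : R => p * x + q.

Lemma measurable_affine p q : measurable_fun setT (affine p q).
Proof.
apply: continuous_mmeasurable => x; apply: cvgD; last exact: cvg_cst.
by apply: cvgMl_tmp; exact: cvg_id.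
Qed.

Lemma preimage_affine (p q a b : R) : 0 < p ->
  affine p q @^-1` `]a, b] = `](a - q) / p, (b - q) / p]%classic.
Proof.
move=> p0; apply/seteqP; split=> x /=; rewrite /affine /= !in_itv /=.
  by rewrite ltr_pdivrMr// ler_pdivlMr// ltrBlDr lerBrDr mulrC.
by rewrite ltr_pdivrMr// ler_pdivlMr// ltrBlDr lerBrDr mulrC.
Qed.

Lemma preimage_naffine (p q a b : R) : p < 0 ->
  affine p q @^-1` `]a, b] = `[(b - q) / p, (a - q) / p[%classic.
Proof.
move=> p0; apply/seteqP; split=> x /=; rewrite /affine /= !in_itv /=.
  by rewrite ltr_ndivlMr// ler_ndivrMr// ltrBlDr lerBrDr (mulrC x) andbC.
by rewrite ltr_ndivlMr// ler_ndivrMr// ltrBlDr lerBrDr (mulrC x) andbC.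
Qed.

(** The rescaled pushforward is a measure with the Lebesgue value on half-open intervals, so
    uniqueness of Lebesgue measure applies. A negative [p] exchanges the open and closed ends, which
    does not change the length. *)
Lemma lebesgue_measure_affine (p q : R) (A : set R) : p != 0 ->
  measurable (A : set RM) ->
  mu A = (`|p|%:E * pushforward mu (affine p q) A)%E.
Proof.
move=> p0 mA.
have mf := measurable_affine p q.
pose nu : {measure set RM -> \bar R} :=
  mscale (NngNum (normr_ge0 p)) (measure_function_pushforward__canonical__measure_function_Measure mu mf).
rewrite (@lebesgue_measure_unique R nu)// => _ [[a b]] _ <- /=.
rewrite [RHS]/(`|p|%:E * mu (affine p q @^-1` `]a, b]))%E.
case: (ltgtP p 0) p0 => // p0 _.
  rewrite preimage_naffine// !lebesgue_measure_itv/= !lte_fin.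
  rewrite ltr_nM2r ?invr_lt0// ltrD2r; case: ifP => _; last by rewrite [RHS](mule0 `|p|%:E).
  congr EFin; rewrite ltr0_norm//; field.
  by rewrite lt_eqF.
rewrite preimage_affine// !lebesgue_measure_itv/= !lte_fin.
rewrite ltr_pM2r ?invr_gt0// ltrD2r; case: ifP => _; last by rewrite [RHS](mule0 `|p|%:E).
congr EFin; rewrite gtr0_norm//; field.
by rewrite gt_eqF.
Qed.

Lemma ge0_integral_affine (p q : R) (f : R -> \bar R) : p != 0 ->
  measurable_fun [set: RM] (f : RM -> \bar R) -> (forall x, 0 <= f x)%E ->
  (\int[mu]_x f x = `|p|%:E * \int[mu]_x f (affine p q x))%E.
Proof.
move=> p0 mf f0; have ma := measurable_affine p q.
pose nu : {measure set RM -> \bar R} :=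
  measure_function_pushforward__canonical__measure_function_Measure mu ma.
rewrite -[X in (_ * X)%E]/(\int[mu]_(x in affine p q @^-1` setT) (f \o affine p q) x)%E.
rewrite -(ge0_integral_pushforward ma)//.
rewrite -[RHS](@ge0_integral_mscale _ _ _ nu _ _ (NngNum (normr_ge0 p)))//.
by apply: eq_measure_integral => A mA _; exact: lebesgue_measure_affine.
Qed.

Lemma integrable_affine (p q : R) f : p != 0 ->
  mu.-integrable setT (EFin \o f) ->
  mu.-integrable setT (EFin \o (fun x => f (p * x + q))).
Proof.
move=> p0 /integrableP[mf fi]; have ma := measurable_affine p q.
apply/integrableP; split.
  exact: (measurableT_comp mf ma).
move: fi; rewrite (@ge0_integral_affine p q)//; last exact: measurableT_comp.
(* An infinite value of [I] is excluded: multiplied by the positive [|p|] it would stay infinite. *)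
set I := (X in (_ * X)%E); rewrite -/I; case: I => [r _|/=|_]; rewrite ?ltry ?ltNyr//.
by rewrite gt0_muley ?lte_fin ?normr_gt0.
Qed.

(** The nonnegative case is applied to the positive and negative parts, both of finite integral. *)
Lemma Rintegral_affine (p q : R) f : p != 0 ->
  mu.-integrable setT (EFin \o f) ->
  \int[mu]_x f (p * x + q) = `|p|^-1 * \int[mu]_x f x.
Proof.
move=> p0 fi.
have np0 : `|p| != 0 by rewrite normr_eq0.
have mf := measurable_int _ fi.
have key (u : R -> \bar R) : measurable_fun [set: RM] (u : RM -> \bar R) ->
    (forall x, 0 <= u x)%E ->
    (\int[mu]_x u (affine p q x) = (`|p|^-1)%:E * \int[mu]_x u x)%E.
  move=> mu0 u0; rewrite [in RHS](@ge0_integral_affine p q)// muleA -EFinM.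
  by rewrite mulVf// mul1e.
rewrite /Rintegral -[fine (\int[mu]_x (f x)%:E)]/(fine (\int[mu]_x (EFin \o f) x)).
have fp := integrable_fin_num measurableT (integrable_funepos measurableT fi).
have fn := integrable_fin_num measurableT (integrable_funeneg measurableT fi).
have E1 : (\int[mu]_x (EFin \o f) x = \int[mu]_x (EFin \o f)^\+ x - \int[mu]_x (EFin \o f)^\- x)%E.
  by rewrite integralE.
have E2 : (\int[mu]_x (f (p * x + q))%:E = (`|p|^-1)%:E * \int[mu]_x (EFin \o f)^\+ x -
   (`|p|^-1)%:E * \int[mu]_x (EFin \o f)^\- x)%E.
  rewrite -(key _ (measurable_funepos mf))//.
  rewrite -(key _ (measurable_funeneg mf))//.
  rewrite [LHS]integralE; congr (_ - _)%E; apply: eq_integral => x _.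
    by rewrite !funeposE.
  by rewrite !funenegE.
by rewrite E1 E2 -(fineK fp) -(fineK fn) -!EFinM -!EFinB /= mulrBr.
Qed.

Lemma dominated_Rintegral_cvg (f_ : nat -> R -> R) f (G : R -> R) :
  (forall n, measurable_fun [set: RM] (f_ n : RM -> R)) ->
  (forall x, f_ n x @[n --> \oo] --> f x) ->
  mu.-integrable setT (EFin \o G) -> (forall n x, `|f_ n x| <= G x) ->
  mu.-integrable setT (EFin \o f) /\
  \int[mu]_x f_ n x @[n --> \oo] --> \int[mu]_x f x.
Proof.
move=> mf_ cf iG fG.
have mf : measurable_fun [set: RM] (f : RM -> R).
  by apply: (measurable_fun_cvg mf_) => x _; exact: cf.
have := @dominated_convergence _ RM R mu setT measurableT
  (fun n => EFin \o f_ n) (EFin \o f) (EFin \o G).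
case.
- by move=> n; apply/measurable_EFinP.
- exact/measurable_EFinP.
- by apply: aeW => x _; apply: cvg_EFin; [exact: nearW|exact: cf].
- by [].
- by apply: aeW => x n _; rewrite lee_fin.
move=> fi _ c; split => //.
by apply: fine_cvg; rewrite fineK//; exact: integrable_fin_num.
Qed.

End RealIntegrals.

(** * Integrals of derivatives over segments and over the line *)

Section RealDerivatives.
Set Implicit Arguments. Unset Strict Implicit.
Context {R : realType}.
Local Notation mu := (@lebesgue_measure R).
Local Notation RM := (measurableTypeR R).
Implicit Types (f F : R -> R).

Lemma derivable_continuous F : (forall x, derivable F x 1) -> continuous F.
Proof. by move=> dF x; exact/differentiable_continuous/derivable1_diffP/dF. Qed.

Lemma Rintegral_itv_derive1 F (a b : R) : a < b ->
  (forall x, derivable F x 1) -> continuous (derive1 F) ->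
  \int[mu]_(x in `[a, b]) derive1 F x = F b - F a.
Proof.
move=> ab dF cF; have contF := @derivable_continuous F dF.
have dab : derivable_oo_LRcontinuous F a b.
  split=> [x _||]; first exact: dF.
  + by have := contF a; exact: cvg_at_right_filter.
  + by have := contF b; exact: cvg_at_left_filter.
have cab : {within `[a, b], continuous (derive1 F)} by exact: continuous_subspaceT.
by rewrite /Rintegral (continuous_FTC2 ab cab dab (fun x _ => erefl)).
Qed.

(* [F (t + n) - F (t - n)] tends to the integral for every [t], while its average
   over [t] in [0, 1] tends to 0 because [F] is integrable. *)
Lemma Rintegral_derive1_eq0 F : (forall x, derivable F x 1) ->
  continuous (derive1 F) -> mu.-integrable setT (EFin \o F) ->
  mu.-integrable setT (EFin \o derive1 F) -> \int[mu]_x derive1 F x = 0.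
Proof.
move=> dF cF iF iF'; have contF := @derivable_continuous F dF.
set L := Rintegral _ _ _.
pose M := \int[mu]_x `|derive1 F x|.
have iM : mu.-integrable setT (EFin \o (fun x => `|derive1 F x|)).
  exact: (integrable_abse iF').
(* The radius [n.+1] keeps the segment nondegenerate for every [n], as the fundamental theorem of
   calculus requires. *)
pose ind n t : R -> R := derive1 F \_ `[t - n.+1%:R, t + n.+1%:R].
pose G n t := F (t + n.+1%:R) - F (t - n.+1%:R).
have mF' : measurable_fun [set: RM] (derive1 F : RM -> R) by exact: continuous_mmeasurable.
have mind n t : measurable_fun [set: RM] (ind n t : RM -> R).
  by apply/measurable_restrict => //; exact: measurable_funS mF'.
have indM n t x : `|ind n t x| <= `|derive1 F x|.
  by rewrite /ind patchE; case: ifP => // _; rewrite normr0.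
have Gind n t : G n t = \int[mu]_x ind n t x.
  rewrite /ind -Rintegral_mkcond Rintegral_itv_derive1//.
  by rewrite ltrD2l gtrN.
have GL t : G n t @[n --> \oo] --> L.
  under eq_fun do rewrite Gind.
  have cx x : ind n t x @[n --> \oo] --> derive1 F x; last first.
    exact: (@dominated_Rintegral_cvg R (ind^~ t) (derive1 F) _ (mind^~ t) cx iM (indM^~ t)).2.
  apply: cvg_near_cst; near=> n; rewrite /ind patchE mem_set//=.
  rewrite in_itv/= -ler_distl (le_trans _ (_ : n%:R <= _))// ?ler_nat//.
  by near: n; exact: nbhs_infty_ger.
have GM n t : `|G n t| <= M.
  rewrite Gind; apply: le_trans (le_normr_Rintegral measurableT _) _.
    by apply: le_integrable iF' => //; [exact/measurable_EFinP|move=> x _; rewrite lee_fin].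
  apply: le_Rintegral => //.
  apply: le_integrable iF' => // [|x _]; last by rewrite /= lee_fin normr_id.
  by apply/measurable_EFinP; exact: measurableT_comp.
pose w : R -> R := \1_(`[0, 1] : set R).
have mw : measurable_fun [set: RM] (w : RM -> R) by exact: measurable_indic.
have w01 x : 0 <= w x <= 1 by rewrite /w indicE; case: (_ \in _); rewrite /= ?lexx ?ler01.
have mu01 : mu (`[0, 1] : set R) = 1%:E.
  by rewrite lebesgue_measure_itv/= lte_fin ltr01 oppr0 adde0.
have iw : mu.-integrable setT (EFin \o w).
  exact: (@integrable_indic_itv R 0 1 true false).
have w1 : \int[mu]_x w x = 1.
  by rewrite /Rintegral integral_indic//= setIT mu01.
have mG n : measurable_fun [set: RM] (G n : RM -> R).
  apply: continuous_mmeasurable => x; apply: cvgB.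
    by apply: continuous_comp; [apply: cvgD; [exact: cvg_id|exact: cvg_cst]|exact: contF].
  by apply: continuous_comp; [apply: cvgB; [exact: cvg_id|exact: cvg_cst]|exact: contF].
(* [G n] is bounded by [M] uniformly in [n], so [M * w] dominates and the pointwise limit [L]
   survives averaging. *)
have c1 : \int[mu]_x (G n x * w x) @[n --> \oo] --> L.
  rewrite -[L]mulr1 -w1 -RintegralZl//.
  have iMw := integrableZl measurableT M iw.
  apply: (@dominated_Rintegral_cvg R (fun n x => G n x * w x) (fun x => L * w x) _ _ _ iMw _).2.
  - by move=> n; exact: measurable_funM.
  - by move=> x; apply: cvgMr_tmp; exact: GL.
  - move=> n x; rewrite normrM /= (ger0_norm (andP (w01 x)).1).
    by rewrite ler_wpM2r ?GM//; case/andP: (w01 x).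
(* A change of variables moves the shift from [F] to the window [w]. The moving window leaves every
   fixed point, and [|F|] dominates. *)
have sh (k : nat -> R) : (forall x, \forall n \near \oo, w (x - k n) = 0) ->
    (forall n, mu.-integrable setT (EFin \o (fun x => F (x + k n) * w x))) /\
    \int[mu]_x (F (x + k n) * w x) @[n --> \oo] --> 0.
  move=> kw.
  have iFw n : mu.-integrable setT (EFin \o (fun x => F x * w (x - k n))).
    apply: le_integrable iF => //.
      apply/measurable_EFinP/measurable_funM; first exact: continuous_mmeasurable.
      have := measurableT_comp mw (measurable_affine 1 (- k n)).
      by rewrite /comp /affine; under eq_fun do rewrite mul1r.
    by move=> x _; rewrite lee_fin normrM ler_piMr// ger0_norm; case/andP: (w01 (x - k n)).
  have e n : (fun x => F (x + k n) * w x) = fun x => F (1 * x + k n) * w (1 * x + k n - k n).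
    by apply/funext => x; rewrite mul1r addrK.
  split=> [n|].
    by rewrite e; exact: (@integrable_affine R 1 (k n) (fun x => F x * w (x - k n)) (oner_neq0 R)).
  under eq_fun.
    move=> n; rewrite e (@Rintegral_affine R 1 (k n) (fun x => F x * w (x - k n)))//.
    rewrite normr1 invr1 mul1r; over.
  have -> : 0 = \int[mu]_x (cst 0 x : R) by rewrite Rintegral_cst// mul0r.
  apply: (@dominated_Rintegral_cvg R (fun n x => F x * w (x - k n)) (cst 0) _ _ _ (integrable_abse iF) _).2.
  - by move=> n; have := measurable_int _ (iFw n) => /measurable_EFinP.
  - move=> x; apply: cvg_near_cst; near=> n.
    by rewrite (near (kw x) n)// mulr0.
  - by move=> n x; rewrite /= normrM ler_piMr// ger0_norm; case/andP: (w01 (x - k n)).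
have [i1 s1] : (forall n, mu.-integrable setT (EFin \o (fun x => F (x + n.+1%:R) * w x))) /\
    \int[mu]_x (F (x + n.+1%:R) * w x) @[n --> \oo] --> 0.
  apply: (sh (fun n => n.+1%:R)) => x; near=> n.
  rewrite /w indicE memNset//= in_itv/= => /andP[+ _].
  apply/negP; rewrite -ltNge subr_lt0 (@lt_trans _ _ n%:R)// ?ltr_nat//.
  by near: n; exact: nbhs_infty_gtr.
have [i2 s2] : (forall n, mu.-integrable setT (EFin \o (fun x => F (x - n.+1%:R) * w x))) /\
    \int[mu]_x (F (x - n.+1%:R) * w x) @[n --> \oo] --> 0.
  apply: (sh (fun n => - n.+1%:R)) => x; near=> n.
  rewrite /w indicE memNset//= in_itv/= => /andP[_].
  apply/negP; rewrite -ltNge opprK addrC -ltrBlDr.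
  rewrite (@lt_trans _ _ n%:R)// ?ltr_nat//.
  by near: n; exact: nbhs_infty_gtr.
have c2 : \int[mu]_x (G n x * w x) @[n --> \oo] --> 0.
  under eq_fun.
    move=> n; under eq_Rintegral do rewrite mulrBl.
    rewrite RintegralB//; over.
  by have := cvgB s1 s2; rewrite subr0; exact.
exact: (cvg_unique _ c1 c2).
Unshelve. all: end_near. Qed.
End RealDerivatives.

(** * Integration and differentiation of complex-valued functions *)

Section ComplexIntegrals.
Set Implicit Arguments. Unset Strict Implicit.
Context {R : realType}.
Local Notation mu := (@lebesgue_measure R).
Local Notation RM := (measurableTypeR R).
Local Notation Re := (@complex.Re R).
Local Notation Im := (@complex.Im R).
Implicit Types (f g : R -> R[i]) (z w : R[i]).

Lemma cmod_le_ReIm z : cmod z <= `|Re z| + `|Im z|.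
Proof.
case: z => a b; rewrite /cmod /= -[leRHS]ger0_norm ?addr_ge0// -sqrtr_sqr.
apply: ler_wsqrtr; rewrite sqrrD !real_normK ?num_real//.
by rewrite lerD2r lerDl mulrn_wge0// mulr_ge0.
Qed.

Lemma cmodC (x : R) : cmod x%:C = `|x|.
Proof. by rewrite /cmod /= expr0n/= addr0 sqrtr_sqr. Qed.

Lemma cmodB z w : cmod (z - w) = cmod (w - z).
Proof. by rewrite -cmodN opprB. Qed.

Lemma cmod_eq0 z : cmod z = 0 -> z = 0.
Proof. by move=> z0; apply/eqP; rewrite -normr_eq0 cmodE z0. Qed.

Lemma complexReB z w : Re (z - w) = Re z - Re w.
Proof. by case: z w => ? ? [? ?]. Qed.
Lemma complexImB z w : Im (z - w) = Im z - Im w.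
Proof. by case: z w => ? ? [? ?]. Qed.

Lemma ccvgP (T : Type) (F : set_system T) (FF : Filter F) (f : T -> R[i]) z :
  ((f x : R[i]^o) @[x --> F] --> (z : R[i]^o)) <->
  (Re (f x) @[x --> F] --> Re z /\ Im (f x) @[x --> F] --> Im z).
Proof.
split=> [fz|[/cvgrPdist_lt re /cvgrPdist_lt im]].
  by split; [exact: (cvg_comp _ _ fz (@continuous_Re R z))|
             exact: (cvg_comp _ _ fz (@continuous_Im R z))].
apply/cvgrPdist_lt => e e0.
(* The radius is taken in [R[i]], where being positive forces it to be real. *)
have eE : e = (Re e)%:C.
  by apply/eqP; move/gtr0_real: e0 => /complex_realP [r ->].
have e0' : 0 < Re e / 2 by rewrite divr_gt0// -ltcR -eE.
near=> x; rewrite cmodE eE ltcR (le_lt_trans (cmod_le_ReIm _))//.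
rewrite complexReB complexImB (splitr (Re e)) ltrD//.
  by near: x; exact: re.
by near: x; exact: im.
Unshelve. all: end_near. Qed.

Lemma ccontinuousP f : continuous (f : R -> R[i]^o) <->
  (continuous (Re \o f) /\ continuous (Im \o f)).
Proof.
split=> [cf|[c1 c2] x].
  by split=> x; have /ccvgP[] := cf x.
by apply/ccvgP; split; [exact: c1|exact: c2].
Qed.

Lemma cderivable_ccontinuous f : (forall x, cderivable f x) ->
  continuous (f : R -> R[i]^o).
Proof. by move=> df; apply/ccontinuousP; exact: cderivable_continuous. Qed.

Lemma cmod_continuous : continuous (cmod : R[i]^o -> R).
Proof.
move=> z; have F := nbhs_filter (z : R[i]^o); apply/cvgrPdist_lt => e e0.
have e0' : 0 < e%:C by rewrite ltcR.
apply: (@filterS _ (nbhs z) (nbhs_filter z) _ _ _ (nbhsx_ballx (z : R[i]^o) _ e0')) => w.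
rewrite -ball_normE /= cmodE ltcR; apply: le_lt_trans.
have h (a b : R[i]) : cmod a - cmod b <= cmod (a - b).
  by rewrite lerBlDr (le_trans _ (cmodD _ _))// subrK.
by rewrite ler_norml h lerNl opprB cmodB h.
Qed.

(** Measurability is componentwise, to match [cintegrable] and [cintegral]. *)
Definition cmeasurable f :=
  measurable_fun [set: RM] (Re \o f : RM -> R) /\
  measurable_fun [set: RM] (Im \o f : RM -> R).

Lemma cintegrable_cmeasurable f : cintegrable f -> cmeasurable f.
Proof.
by move=> [/measurable_int/measurable_EFinP ? /measurable_int/measurable_EFinP ?].
Qed.

Lemma measurable_cmod f : cmeasurable f ->
  measurable_fun [set: RM] (cmod \o f : RM -> R).
Proof.
move=> [m1 m2].
rewrite (_ : cmod \o f = Num.sqrt \o (fun x => Re (f x) ^+ 2 + Im (f x) ^+ 2)).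
  apply: measurableT_comp; last first.
    by apply: measurable_funD; apply: measurable_funX.
  by apply: continuous_measurable_fun; exact: sqrt_continuous.
by apply/funext => x /=; rewrite /cmod; case: (f x).
Qed.

Lemma cintegrable_le f (G : R -> R) : cmeasurable f ->
  mu.-integrable setT (EFin \o G) -> (forall x, cmod (f x) <= G x) ->
  cintegrable f.
Proof.
move=> [m1 m2] iG fG; split; apply: le_integrable iG => //; try exact/measurable_EFinP.
- move=> x _; rewrite lee_fin (le_trans (ler_Re_cmod _))//.
  by rewrite (le_trans (fG x))// ler_norm.
- move=> x _; rewrite lee_fin (le_trans (ler_Im_cmod _))//.
  by rewrite (le_trans (fG x))// ler_norm.
Qed.

Lemma integrable_cmod f : cintegrable f -> mu.-integrable setT (EFin \o (cmod \o f)).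
Proof.
move=> if_; have mf := cintegrable_cmeasurable if_; case: if_ => i1 i2.
have := integrableD measurableT (integrable_abse i1) (integrable_abse i2).
apply: le_integrable => //.
  by apply/measurable_EFinP; exact: measurable_cmod.
move=> x _ /=; rewrite lee_fin (ger0_norm (cmod_ge0 _)).
by rewrite (le_trans (cmod_le_ReIm _))// ler_norm.
Qed.

(** The factor 2 comes from bounding the real and the imaginary part of the integral separately,
    each by the integral of [G]. *)
Lemma cmod_cintegral_le f (G : R -> R) : cintegrable f ->
  mu.-integrable setT (EFin \o G) -> (forall x, cmod (f x) <= G x) ->
  cmod (cintegral f) <= 2 * \int[mu]_x G x.
Proof.
move=> [i1 i2] iG fG; apply: le_trans (cmod_le_ReIm _) _.
rewrite mulr_natl mulr2n; apply: lerD; rewrite /=.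
  apply: le_trans (le_normr_Rintegral measurableT i1) _.
  apply: le_Rintegral => //; first exact: (integrable_abse i1).
  by move=> x _; exact: le_trans (ler_Re_cmod _) (fG x).
apply: le_trans (le_normr_Rintegral measurableT i2) _.
apply: le_Rintegral => //; first exact: (integrable_abse i2).
by move=> x _; exact: le_trans (ler_Im_cmod _) (fG x).
Qed.

Lemma dominated_cintegral_cvg (f_ : nat -> R -> R[i]) f (G : R -> R) :
  (forall n, cmeasurable (f_ n)) ->
  (forall x, (f_ n x : R[i]^o) @[n --> \oo] --> (f x : R[i]^o)) ->
  mu.-integrable setT (EFin \o G) -> (forall n x, cmod (f_ n x) <= G x) ->
  cintegrable f /\
  (cintegral (f_ n) : R[i]^o) @[n --> \oo] --> (cintegral f : R[i]^o).
Proof.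
move=> mf_ cf iG fG.
have [i1 c1] := @dominated_Rintegral_cvg R (fun n => Re \o f_ n) (Re \o f) G
  (fun n => (mf_ n).1) (fun x => ((ccvgP _ _ _).1 (cf x)).1) iG
  (fun n x => le_trans (ler_Re_cmod _) (fG n x)).
have [i2 c2] := @dominated_Rintegral_cvg R (fun n => Im \o f_ n) (Im \o f) G
  (fun n => (mf_ n).2) (fun x => ((ccvgP _ _ _).1 (cf x)).2) iG
  (fun n x => le_trans (ler_Im_cmod _) (fG n x)).
split; first by split.
by apply/ccvgP; split.
Qed.

Lemma cintegral_affine (p q : R) f : p != 0 -> cintegrable f ->
  cintegrable (fun x => f (p * x + q)) /\
  cintegral (fun x => f (p * x + q)) = (`|p|^-1)%:C * cintegral f.
Proof.
move=> p0 [i1 i2]; split.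
  by split; [exact: (integrable_affine q p0 i1)|exact: (integrable_affine q p0 i2)].
have e1 := Rintegral_affine q p0 i1; have e2 := Rintegral_affine q p0 i2.
rewrite /cintegral; apply/eqP; rewrite eq_complex /= !mul0r subr0 addr0.
by rewrite -e1 -e2 !eqxx.
Qed.

Lemma cintegral_cderive_eq0 f : (forall x, cderivable f x) ->
  continuous (cderive f : R -> R[i]^o) -> cintegrable f ->
  cintegrable (cderive f) -> cintegral (cderive f) = 0.
Proof.
move=> df /ccontinuousP[c1 c2] [i1 i2] [j1 j2]; rewrite /cintegral /=.
have e1 := @Rintegral_derive1_eq0 R (Re \o f) (fun x => (df x).1) c1 i1 j1.
have e2 := @Rintegral_derive1_eq0 R (Im \o f) (fun x => (df x).2) c2 i2 j2.
by rewrite e1 e2.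
Qed.

Lemma cderivableM f g x : cderivable f x -> cderivable g x ->
  cderivable (fun y => f y * g y) x /\
  cderive (fun y => f y * g y) x = cderive f x * g x + f x * cderive g x.
Proof.
move=> [f1 f2] [g1 g2].
have dM (u v : R -> R) : derivable u x 1 -> derivable v x 1 ->
    is_derive x (1 : R) (u * v) (u x * derive1 v x + v x * derive1 u x).
  move=> /derivableP du /derivableP dv; rewrite !derive1E.
  exact: is_deriveM.
have ReE : Re \o (fun y => f y * g y) =
    (Re \o f) * (Re \o g) - (Im \o f) * (Im \o g).
  by apply/funext => y; rewrite /= Defs.ReM.
have ImE : Im \o (fun y => f y * g y) =
    (Re \o f) * (Im \o g) + (Im \o f) * (Re \o g).
  by apply/funext => y; rewrite /= Defs.ImM.
have r := is_deriveB (dM _ _ f1 g1) (dM _ _ f2 g2).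
have i := is_deriveD (dM _ _ f1 g2) (dM _ _ f2 g1).
rewrite /cderivable /cderive ReE ImE; split; first by split; exact: ex_derive.
rewrite !derive1E (@derive_val _ _ _ _ _ _ _ r) (@derive_val _ _ _ _ _ _ _ i).
apply/eqP; rewrite eq_complex Defs.ReD Defs.ImD !Defs.ReM !Defs.ImM /= -!derive1E.
by apply/andP; split; apply/eqP; ring.
Qed.

(** Differentiation under the integral sign, component by component. Domination is asked only within
    distance 1 of [a], because the bound on a translated kernel [phi (t - y)] is uniform only for
    bounded [t]. *)
Lemma cderive_cintegral (K : R -> R -> R[i]) (a : R) (G : R -> R) :
  (forall x, cintegrable (K x)) ->
  (forall x y, cderivable (K^~ y) x) ->
  mu.-integrable setT (EFin \o G) ->
  (forall x y, `|x - a| < 1 -> cmod (cderive (K^~ y) x) <= G y) ->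
  cderivable (fun x => cintegral (K x)) a /\
  cderive (fun x => cintegral (K x)) a = cintegral (fun y => cderive (K^~ y) a).
Proof.
move=> iK dK iG KG.
have Ia : `]a - 1, a + 1[%classic a.
  by rewrite /= in_itv/= ltrBlDr ltrDl ltr01.
have I1 x : `]a - 1, a + 1[%classic x -> `|x - a| < 1.
  by rewrite /= in_itv/= -ltr_distl.
have G0 y : 0 <= G y.
  by apply: le_trans (cmod_ge0 _) (KG a y _); rewrite subrr normr0.
have b1 x y : `]a - 1, a + 1[%classic x -> setT y ->
    `|partial1of2 (fun x y => Re (K x y)) x y| <= G y.
  move=> /I1 xa _; apply: le_trans (KG x y xa).
  exact: (ler_Re_cmod (cderive (K^~ y) x)).
have b2 x y : `]a - 1, a + 1[%classic x -> setT y ->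
    `|partial1of2 (fun x y => Im (K x y)) x y| <= G y.
  move=> /I1 xa _; apply: le_trans (KG x y xa).
  exact: (ler_Im_cmod (cderive (K^~ y) x)).
split; first split.
- exact: (@derivable_under_integral R _ RM mu
  (fun x y => Re (K x y)) setT measurableT a _ _ Ia
  (fun x _ => (iK x).1) (fun x y _ _ => (dK x y).1) G G0 iG b1).
- exact: (@derivable_under_integral R _ RM mu
  (fun x y => Im (K x y)) setT measurableT a _ _ Ia
  (fun x _ => (iK x).2) (fun x y _ _ => (dK x y).2) G G0 iG b2).
rewrite /cderive /cintegral; congr (_ +i* _).
- exact: (@differentiation_under_integral R _ RM mu
  (fun x y => Re (K x y)) setT measurableT a _ _ Ia
  (fun x _ => (iK x).1) (fun x y _ _ => (dK x y).1) G G0 iG b1).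
- exact: (@differentiation_under_integral R _ RM mu
  (fun x y => Im (K x y)) setT measurableT a _ _ Ia
  (fun x _ => (iK x).2) (fun x y _ _ => (dK x y).2) G G0 iG b2).
Qed.

End ComplexIntegrals.

(** * Convolution with Schwartz functions *)

Section Convolution.
Set Implicit Arguments. Unset Strict Implicit.
Context {R : realType}.
Local Notation mu := (@lebesgue_measure R).
Implicit Types (f g h phi : R -> R[i]) (c z w : R[i]).

Lemma Cb_affine f (p q : R) : Cb f -> Cb (fun y => f (p * y + q)).
Proof.
move=> [cf [M fM]]; split; last by exists M.
move=> x; apply: (@continuous_comp R R R[i]^o (fun y => p * y + q) f); last exact: cf.
by apply: cvgD; [apply: cvgMl_tmp; exact: cvg_id|exact: cvg_cst].
Qed.

Lemma Cb_reflect f (x : R) : Cb f -> Cb (fun y => f (x - y)).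
Proof.
move=> /(@Cb_affine _ (-1) x); congr Cb.
by apply/funext => y; rewrite mulN1r addrC.
Qed.

Lemma cderivableZ c f x : cderivable f x ->
  cderivable (fun y => c * f y) x /\
  cderive (fun y => c * f y) x = c * cderive f x.
Proof.
move=> df; have := cderivableP c df (@smooth0 R 0%N x).
by rewrite /= addr0 (_ : cderive 0 x = 0) ?addr0//; rewrite -[cderive 0]/(cderiven 1 0) cderiven0.
Qed.

Lemma schwartz_cderiven n phi : schwartz phi -> schwartz (cderiven n phi).
Proof.
move=> [sphi bphi]; have e k : cderiven k (cderiven n phi) = cderiven (k + n) phi.
  by rewrite /cderiven iterD.
by split=> [k x|m k]; rewrite e; [exact: sphi|exact: bphi].
Qed.

Lemma schwartz_cintegrable phi : schwartz phi -> cintegrable phi.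
Proof. by move=> /schwartz_DL1[_ /(_ 0%N)]. Qed.

Lemma schwartz_decay phi : schwartz phi ->
  exists2 N : R, 0 <= N & forall t, cmod (phi t) <= N * (oneDsqr t)^-1.
Proof.
move=> [_ bphi]; have [[M fM] [N fN]] := (bphi 0%N 0%N, bphi 2%N 0%N).
exists (M + N) => [|t].
  have := fM 0; have := fN 0; rewrite /= normr0 expr0 expr0n/= mul0r mul1r => N0 M0.
  by rewrite addr_ge0// (le_trans _ M0)// cmod_ge0.
rewrite ler_pdivlMr ?(lt_le_trans ltr01 (oneDsqr_ge1 _))// mulrC /oneDsqr mulrDl lerD//.
  by have := fM t; rewrite expr0.
by have := fN t; rewrite -normrX (ger0_norm (sqr_ge0 _)).
Qed.

Definition convol f phi : R -> R[i] := fun x => cintegral (fun y => f (x - y) * phi y).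

Lemma convol_cintegrable f phi x : Cb f -> cintegrable phi ->
  cintegrable (fun y => f (x - y) * phi y).
Proof. by move=> bf; apply: Cb_cintegrable; exact: Cb_reflect. Qed.

Lemma convol_bound f phi (M : R) x : Cb f -> cintegrable phi ->
  (forall x, cmod (f x) <= M) ->
  cmod (convol f phi x) <= 2 * (M * \int[mu]_y cmod (phi y)).
Proof.
move=> bf iphi fM; rewrite -RintegralZl//; last exact: integrable_cmod.
apply: cmod_cintegral_le; first exact: convol_cintegrable.
  exact: (integrableZl measurableT M (integrable_cmod iphi)).
by move=> y; rewrite cmodM ler_wpM2r ?cmod_ge0.
Qed.

Lemma convol_lin c f g phi : Cb f -> Cb g -> cintegrable phi ->
  convol (c *: f + g) phi = c *: convol f phi + convol g phi.
Proof.
move=> bf bg iphi; apply/funext => x.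
apply: etrans (cintegral_lin c (convol_cintegrable x bf iphi) (convol_cintegrable x bg iphi)).2.
by rewrite /convol; congr cintegral; apply/funext => y; rewrite !fctE mulrDl scalerAl.
Qed.

(** Puts the variable [x] in the factor [phi], so that differentiation in [x] falls on [phi] when
    [f] is merely continuous. *)
Lemma convol_reflect f phi x : Cb f -> cintegrable phi ->
  cintegrable (fun y => f y * phi (x - y)) /\
  convol f phi x = cintegral (fun y => f y * phi (x - y)).
Proof.
move=> bf iphi.
have N10 : (-1 : R) != 0 by rewrite oppr_eq0 oner_eq0.
have := cintegral_affine x N10 (convol_cintegrable x bf iphi).
rewrite normrN1 invr1 mul1r (_ : (fun y => _) = (fun y => f y * phi (x - y))).
  by case=> ? ->.
by apply/funext => y; rewrite mulN1r opprD opprK addrCA subrr addr0 addrC.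
Qed.

Lemma cderive_convol f phi x : Cb f -> schwartz phi ->
  cderivable (convol f phi) x /\
  cderive (convol f phi) x = convol f (cderive phi) x.
Proof.
move=> bf sphi; have iphi := schwartz_cintegrable sphi.
have sphi' := schwartz_cderiven 1 sphi.
have iphi' := schwartz_cintegrable sphi'.
rewrite (_ : convol f phi = fun t => cintegral (fun y => f y * phi (t - y))); last first.
  by apply/funext => t; rewrite (convol_reflect t bf iphi).2.
have [_ [M fM]] := bf.
have [N N0 phiN] := schwartz_decay sphi'.
have dphi (t y : R) : cderivable (fun s => f y * phi (s - y)) t /\
    cderive (fun s => f y * phi (s - y)) t = f y * cderive phi (t - y).
  have [d e] := cderivable_affine 1 (- y) (sphi.1 0%N).
  have eE : (fun s => phi (1 * s - y)) = (fun s => phi (s - y)).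
    by apply/funext => s; rewrite mul1r.
  rewrite [fun s => _]eE in d e.
  have [d1 e1] := cderivableZ (f y) (d t).
  by split; [exact: d1|rewrite e1 e /= mul1r mul1r].
(* Peetre-type constant: [1 + y^2 <= (2 + 2 t^2) (1 + (t - y)^2)], with [|t| <= |x| + 1]. It follows
   from [2 t^2 + 2 (t - y)^2 - y^2 = (2 t - y)^2], which explains the squares supplied to [nra]
   below. *)
pose K := 2 + 2 * (`|x| + 1) ^+ 2.
have iG := integrableZl measurableT (M * (N * K)) (@integrable_oneDsqrV R).
have [|||d e] := @cderive_cintegral R (fun t y => f y * phi (t - y)) x _ _ _ iG.
- by move=> t; exact: (convol_reflect t bf iphi).1.
- by move=> t y; exact: (dphi t y).1.
- move=> t y tx; rewrite (dphi t y).2 cmodM -mulrA.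
  apply: ler_pM; rewrite ?cmod_ge0//.
  apply: le_trans (phiN _) _; rewrite -mulrA ler_wpM2l//.
  rewrite ler_pdivlMr ?(lt_le_trans ltr01 (oneDsqr_ge1 _))//.
  rewrite mulrC ler_pdivrMr ?(lt_le_trans ltr01 (oneDsqr_ge1 _))//.
  have ht : `|t| <= `|x| + 1.
    by rewrite -(subrK x t) addrC (le_trans (ler_normD _ _))// lerD2l ltW.
  have ht2 : t ^+ 2 <= (`|x| + 1) ^+ 2.
    by rewrite -(real_normK (num_real t)) lerXn2r// nnegrE ?addr_ge0.
  rewrite /oneDsqr /K.
  have := sqr_ge0 (t - y); have := sqr_ge0 (2 * t - y).
  move: ht2; set A := (_ + 1) ^+ 2; nra.
split=> //; rewrite e (convol_reflect x bf iphi').2.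
by congr cintegral; apply/funext => y; rewrite (dphi x y).2.
Qed.

End Convolution.

(** * Smoothness of convolutions and stability of the function classes *)

Section ConvolutionRegularity.
Set Implicit Arguments. Unset Strict Implicit.
Context {R : realType}.
Local Notation mu := (@lebesgue_measure R).
Implicit Types (f g h phi : R -> R[i]) (c z w : R[i]).

Lemma cderiven_convol n f phi : Cb f -> schwartz phi ->
  (forall x, cderivable (cderiven n (convol f phi)) x) /\
  cderiven n (convol f phi) = convol f (cderiven n phi).
Proof.
move=> bf sphi.
have key m : cderiven m (convol f phi) = convol f (cderiven m phi).
  elim: m => // m IH; rewrite [LHS]/= IH; apply/funext => x.
  by rewrite (cderive_convol x bf (schwartz_cderiven m sphi)).2.
by split=> // x; rewrite key; exact: (cderive_convol x bf (schwartz_cderiven n sphi)).1.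
Qed.

Lemma smooth_convol f phi : Cb f -> schwartz phi -> smooth (convol f phi).
Proof. by move=> bf sphi n; exact: (cderiven_convol n bf sphi).1. Qed.

Lemma Cb_convol f phi : Cb f -> schwartz phi -> Cb (convol f phi).
Proof.
move=> bf sphi; split.
  by apply: cderivable_ccontinuous => x; exact: (cderive_convol x bf sphi).1.
have [_ [M fM]] := bf.
exists (2 * (M * \int[mu]_y cmod (phi y))) => x.
exact: (convol_bound x bf (schwartz_cintegrable sphi) fM).
Qed.

Lemma cvg_cmod_le (M : R) (u : nat -> R[i]) z :
  (u n : R[i]^o) @[n --> \oo] --> (z : R[i]^o) ->
  (forall n, cmod (u n) <= M) -> cmod z <= M.
Proof.
move=> uz uM; have c := cvg_comp _ _ uz (@cmod_continuous R z).
by apply: (cvgr_to_le c); apply: nearW => n; exact: uM.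
Qed.

(* An unbounded sequence of values of [g] would have no convergent subsequence. *)
Lemma aa_Cb g : almost_automorphic g -> Cb g.
Proof.
move=> [cg ag]; split=> //; apply/not_existsP => unb.
have unb' (n : nat) : {x | n%:R < cmod (g x)}.
  apply: cid; have /existsNP[x xn] := unb n%:R; exists x.
  by rewrite ltNge; exact/negP.
have [k hk [g' [g1 _]]] := ag (fun n => sval (unb' n)).
have c := cvg_comp _ _ (g1 0) (@cmod_continuous R (g' 0)).
have nk n : (n <= k n)%N.
  by elim: n => // n /leq_ltn_trans; apply; exact: hk.
have /cvgrPdist_lt /(_ 1 ltr01) c1 := c.
have : \forall n \near \oo, False.
  near=> n; have : `|cmod (g' 0) - cmod (g (0 + sval (unb' (k n))))| < 1.
    by near: n; exact: c1.
  rewrite add0r ltr_distlC => /andP[_].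
  apply/negP; rewrite -leNgt; apply: le_trans (ltW (svalP (unb' (k n)))).
  apply: (@le_trans _ _ n%:R); last by rewrite ler_nat.
  by near: n; exact: nbhs_infty_ger.
by case=> N _ /(_ N (leqnn N)).
Unshelve. all: end_near. Qed.

(** The subsequence extracted for [g] also serves for the convolution, with limit [convol g' phi].
    Since [g'] is a mere pointwise limit and may be discontinuous, the integrability of its product
    with [phi] comes out of dominated convergence ([D1]) and is then reused for the way back. *)
Lemma aa_convol g phi : almost_automorphic g -> schwartz phi ->
  almost_automorphic (convol g phi).
Proof.
move=> ag sphi; have bg := aa_Cb ag; have iphi := schwartz_cintegrable sphi.
split; first by case: (Cb_convol bg sphi).
have [_ [M gM]] := bg.
move=> s; have [k hk [g' [g1 g2]]] := ag.2 s; exists k => //.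
have g'M x : cmod (g' x) <= M.
  by apply: (cvg_cmod_le (g1 x)) => n; exact: gM.
have iG := integrableZl measurableT M (integrable_cmod iphi).
have bnd (a : R -> R[i]) : (forall x, cmod (a x) <= M) ->
    forall x y, cmod (a (x - y) * phi y) <= M * cmod (phi y).
  by move=> aM x y; rewrite cmodM ler_wpM2r ?cmod_ge0.
have D1 x : cintegrable (fun y => g' (x - y) * phi y) /\
    (convol g phi (x + s (k n)) : R[i]^o) @[n --> \oo] --> (convol g' phi x : R[i]^o).
  apply: (@dominated_cintegral_cvg R
    (fun n y => g (x + s (k n) - y) * phi y) (fun y => g' (x - y) * phi y) _
    (fun n => cintegrable_cmeasurable (convol_cintegrable _ bg iphi)) _ iG
    (fun n y => bnd g gM (x + s (k n)) y)) => y.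
  apply: (@cvgMr_tmp R[i]).
  by under eq_fun do rewrite addrAC; exact: g1.
exists (convol g' phi); split=> x; first exact: (D1 x).2.
have [||_ //] := @dominated_cintegral_cvg R
  (fun n y => g' (x - s (k n) - y) * phi y) (fun y => g (x - y) * phi y) _
  _ _ iG (fun n y => bnd g' g'M (x - s (k n)) y).
- by move=> n; exact: cintegrable_cmeasurable (D1 _).1.
- move=> y; apply: (@cvgMr_tmp R[i]).
  by under eq_fun do rewrite addrAC; exact: g2.
Qed.

Lemma Cplus0_convol h phi : Cplus0 h -> schwartz phi -> Cplus0 (convol h phi).
Proof.
move=> [bh h0] sphi; have iphi := schwartz_cintegrable sphi.
split; first exact: Cb_convol.
have [_ [M hM]] := bh.
have iG := integrableZl measurableT M (integrable_cmod iphi).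
(* Sequential form of the limit at [+oo], as dominated convergence requires. *)
have key (u : nat -> R) : u n @[n --> \oo] --> +oo ->
    (convol h phi (u n) : R[i]^o) @[n --> \oo] --> (0 : R[i]^o).
  move=> uoo; rewrite -(@cintegral0 R).
  apply: (@dominated_cintegral_cvg R (fun n y => h (u n - y) * phi y) 0 _ _ _ iG _).2.
  - by move=> n; exact: cintegrable_cmeasurable (convol_cintegrable _ bh iphi).
  - move=> y; rewrite -[X in _ --> X](mul0r (phi y)); apply: (@cvgMr_tmp R[i]).
    apply: (cvg_comp _ _ _ h0).
    apply/cvgryPge => A; near=> n; rewrite lerBrDr.
    by near: n; move/cvgryPge : uoo; exact.
  - by move=> n y; rewrite cmodM ler_wpM2r ?cmod_ge0.
apply/ccvgP; split; apply/cvg_pinftyP => u /key/ccvgP[]//.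
Unshelve. all: end_near. Qed.

(** A convolution sees [f] on the whole line, while the definition splits it only for [0 <= x].
    Taking [f - g] as the vanishing part makes the splitting global: it is bounded because [g] is,
    and it agrees with the original [h] near [+oo]. *)
Lemma CaaaE f : Caaa f ->
  exists g h, [/\ almost_automorphic g, Cplus0 h & f = g + h].
Proof.
move=> [bf [g [h [ag [bh h0] fgh]]]]; exists g, (f - g); split; [exact: ag| |by rewrite addrC subrK].
have fgE : f - g = (-1) *: g + f by rewrite scaleN1r addrC.
split; first by rewrite fgE; exact: (Cb_lin (-1) (aa_Cb ag) bf).
apply: cvg_trans h0; apply: near_eq_cvg; near=> x.
rewrite !fctE fgh; first by rewrite addrAC subrr add0r.
by near: x; exact: nbhs_pinfty_ge.
Unshelve. all: end_near. Qed.

Lemma Caaa_convol f phi : Caaa f -> schwartz phi -> Caaa (convol f phi).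
Proof.
move=> cf sphi; have [bf _] := cf; split; first exact: Cb_convol.
have [g [h [ag ph ->]]] := CaaaE cf.
exists (convol g phi), (convol h phi); split.
- exact: aa_convol.
- exact: Cplus0_convol.
- move=> x _; rewrite -[g]scale1r (convol_lin _ (aa_Cb ag) ph.1)//.
    by rewrite !scale1r.
  exact: schwartz_cintegrable.
Qed.

(** The product [g * phi] and its derivative are integrable, all integrability coming from [phi], so
    the derivative of the product has zero integral. *)
Lemma cintegral_by_parts g phi : Cb g -> (forall x, cderivable g x) ->
  Cb (cderive g) -> is_DL1 phi ->
  cintegral (fun x => g x * cderive phi x) =
  - cintegral (fun x => cderive g x * phi x).
Proof.
move=> bg dg bg' [sphi iphi].
have dM x := cderivableM (dg x) (sphi 0%N x).
have e : cderive (fun x => g x * phi x) =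
    1 *: (fun x => g x * cderive phi x) + (fun x => cderive g x * phi x).
  by apply/funext => x; rewrite (dM x).2 scale1r addrC.
have i0 := Cb_cintegrable bg (iphi 0%N).
have i1 := Cb_cintegrable bg (iphi 1%N).
have i2 := Cb_cintegrable bg' (iphi 0%N).
have [i3 e3] := cintegral_lin 1 i1 i2; rewrite mul1r in e3.
have := @cintegral_cderive_eq0 R (fun x => g x * phi x) (fun x => (dM x).1).
rewrite e e3 => H; apply/eqP; rewrite -addr_eq0; apply/eqP; apply: H => //.
apply: continuous_lin => x.
  apply: (@cvgM _ _ _ _ g (cderive phi)); first exact: bg.1.
  exact: (cderivable_ccontinuous (sphi 1%N)).
apply: (@cvgM _ _ _ _ (cderive g) phi); first exact: bg'.1.
exact: (cderivable_ccontinuous (sphi 0%N)).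
Qed.

Lemma convol_cderive f phi : Cb f -> (forall x, cderivable f x) ->
  Cb (cderive f) -> schwartz phi -> convol f (cderive phi) = convol (cderive f) phi.
Proof.
move=> bf df bf' sphi; apply/funext => x; rewrite /convol.
have [d e] := cderivable_affine (-1) x df.
have eE (u : R -> R[i]) : (fun y => u (-1 * y + x)) = (fun y => u (x - y)).
  by apply/funext => y; rewrite mulN1r addrC.
rewrite eE in d e.
have {}e : cderive (fun y => f (x - y)) = - (fun y => cderive f (x - y)).
  by rewrite e -eE; apply/funext => y; rewrite rmorphN mulN1r.
have b' := Cb_reflect x bf'.
have bN : Cb (- (fun y => cderive f (x - y))).
  by rewrite -scaleN1r -[X in Cb X]addr0; exact: (Cb_lin (-1) b' Cb0).
rewrite (cintegral_by_parts (Cb_reflect x bf) d _ (schwartz_DL1 sphi)) e//.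
have ib := Cb_cintegrable b' (schwartz_cintegrable sphi).
have [_] := cintegral_lin (-1) ib (@cintegrable0 R).
rewrite cintegral0 !addr0 mulN1r => e2; rewrite -[RHS]opprK -e2.
by congr (- cintegral _); apply/funext => y; rewrite !fctE scaleN1r mulNr.
Qed.

Lemma convol_cderiven n f phi : smooth f -> (forall k, Cb (cderiven k f)) ->
  schwartz phi -> convol f (cderiven n phi) = convol (cderiven n f) phi.
Proof.
move=> + + sphi; elim: n f => // n IH f sf bf.
rewrite -(cderivenS n f) -IH; last 2 first.
- exact: smooth_cderive.
- by move=> k; rewrite cderivenS.
exact: (convol_cderive (bf 0%N) (sf 0%N) (bf 1%N) (schwartz_cderiven n sphi)).
Qed.

End ConvolutionRegularity.

(** * Mollifiers, distributions and supremum norms *)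

Section Mollification.
Set Implicit Arguments. Unset Strict Implicit.
Context {R : realType}.
Local Notation mu := (@lebesgue_measure R).
Implicit Types (f g h phi : R -> R[i]) (c z w : R[i]).

Lemma cderiven_mollifier n (rho : R -> R[i]) (e : R) : schwartz rho -> e != 0 ->
  cderiven n (mollifier rho e) =
  fun x => (e ^- n.+1)%:C * cderiven n rho (e^-1 * x + 0).
Proof.
move=> [srho _] e0; have [d E] := cderiven_affine e^-1 0 n srho.
have sa : smooth (fun y => rho (e^-1 * y + 0)).
  by move=> k; exact: (cderiven_affine e^-1 0 k srho).1.
have -> : mollifier rho e = (e^-1)%:C *: (fun y => rho (e^-1 * y + 0)) + 0.
  by apply/funext => x; rewrite !fctE addr0 mulrC addr0.
rewrite (cderivenP _ _ sa smooth0) cderiven0 addr0 E; apply/funext => x.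
by rewrite !fctE /= [LHS]mulrA -rmorphM/= exprS invfM exprVn.
Qed.

(** Rescaling moves [e] into the argument of the bounded function [f] and leaves the fixed weight
    [cderiven n rho]; this is what provides dominating functions independent of [e]. *)
Lemma convol_mollifier n f (rho : R -> R[i]) (e : R) x : 0 < e -> Cb f ->
  schwartz rho ->
  cintegrable (fun y => f (x - e * y) * cderiven n rho y) /\
  convol f (cderiven n (mollifier rho e)) x =
    (e ^- n)%:C * cintegral (fun y => f (x - e * y) * cderiven n rho y).
Proof.
move=> e0 bf srho; have en0 : e != 0 by rewrite gt_eqF.
have ie : e^-1 != 0 by rewrite invr_neq0.
have ixy : cintegrable (fun y => f (x - e * y) * cderiven n rho y).
  apply: Cb_cintegrable; last exact: (schwartz_cintegrable (schwartz_cderiven n srho)).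
  have := Cb_affine (- e) x bf; congr Cb.
  by apply/funext => y; rewrite mulNr addrC.
split=> //; have [ia ea] := cintegral_affine 0 ie ixy.
have -> : cintegral (fun y => f (x - e * y) * cderiven n rho y) =
    (e^-1)%:C * cintegral (fun y => f (x - e * (e^-1 * y + 0)) * cderiven n rho (e^-1 * y + 0)).
  rewrite ea mulrA -rmorphM/= normfV invrK (gtr0_norm e0) mulVf//.
  by rewrite mul1r.
rewrite mulrA -rmorphM/= -invfM -exprSr.
have [_ e2] := cintegral_lin (e ^- n.+1)%:C ia (@cintegrable0 R).
rewrite cintegral0 !addr0 in e2; rewrite -e2.
rewrite /convol (cderiven_mollifier n srho en0).
congr cintegral; apply/funext => y; rewrite !fctE addr0 mulrCA /=.
by rewrite [e * _]mulrA mulfV// mul1r.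
Qed.

Lemma convol_mollifier_bound n f (rho : R -> R[i]) (e : R) (M : R) x :
  0 < e -> Cb f -> (forall x, cmod (f x) <= M) -> schwartz rho ->
  cmod (convol f (cderiven n (mollifier rho e)) x) <=
  2 * (M * \int[mu]_y cmod (cderiven n rho y)) * e ^- n.
Proof.
move=> e0 bf fM srho; have [ic ->] := convol_mollifier n x e0 bf srho.
have irho := schwartz_cintegrable (schwartz_cderiven n srho).
rewrite cmodM cmodC ger0_norm ?invr_ge0 ?exprn_ge0 ?(ltW e0)// mulrC.
rewrite ler_wpM2r ?invr_ge0 ?exprn_ge0 ?(ltW e0)//.
rewrite -RintegralZl//; last exact: integrable_cmod.
apply: cmod_cintegral_le => //.
  exact: (integrableZl measurableT M (integrable_cmod irho)).
by move=> y; rewrite cmodM ler_wpM2r ?cmod_ge0.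
Qed.

Lemma iter_DL1_derivE j (phi : DL1 R) :
  iter j (@DL1_deriv R) phi = cderiven j phi :> (R -> R[i]).
Proof. by elim: j => //= j <-. Qed.

Lemma iter_dist_derivE j (T : DL1 R -> R[i]) (phi : DL1 R) :
  iter j (@dist_deriv R) T phi = (-1) ^+ j * T (iter j (@DL1_deriv R) phi).
Proof.
elim: j phi => [|j IH] phi; first by rewrite expr0 mul1r.
by rewrite [LHS]/= {1}/dist_deriv IH -iterSr exprS mulN1r mulNr.
Qed.

(** Two signs [(-1)^j] cancel: one from the duality defining [dist_deriv], the other from the chain
    rule for the reflected test function [phi (x - y)]. *)
Lemma dist_conv_dist_deriv j f phi (sphi : schwartz phi) : Cb f ->
  dist_conv (iter j (@dist_deriv R) (dist_of f)) sphi = convol f (cderiven j phi).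
Proof.
move=> bf; apply/funext => x; rewrite /dist_conv iter_dist_derivE /dist_of.
rewrite iter_DL1_derivE /=.
have -> : (fun y => phi (x - y)) = fun y => phi (-1 * y + x).
  by apply/funext => y; rewrite mulN1r addrC.
have iphi := schwartz_cintegrable (schwartz_cderiven j sphi).
have [i e] := convol_reflect x bf iphi.
rewrite (cderiven_affine (-1) x j sphi.1).2 e.
have [_ e2] := cintegral_lin ((-1) ^+ j) i (@cintegrable0 R).
rewrite cintegral0 !addr0 in e2.
transitivity ((-1) ^+ j * ((-1) ^+ j * cintegral (fun y => f y * cderiven j phi (x - y)))).
  rewrite -e2; congr (_ * cintegral _); apply/funext => y; rewrite !fctE.
  by rewrite mulrCA rmorphXn rmorphN mulN1r addrC.
by rewrite mulrA -expr2 sqrr_sign mul1r.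
Qed.

Lemma Linf_norm_le f (M : R) : (forall x, cmod (f x) <= M) ->
  (Linf_norm f <= M%:E)%E.
Proof.
move=> fM; rewrite /Linf_norm unlock; case: ifPn => _.
  apply/ess_supP; apply: aeW => x /=.
  by rewrite lee_fin ger0_norm ?cmod_ge0.
by rewrite lee_fin (le_trans (cmod_ge0 (f 0))).
Qed.

(** By continuity, a value exceeding [M] at [x] would persist on an open interval, which has
    positive measure and so cannot lie in a null set. *)
Lemma Linf_norm_ge f (M : R) x : continuous (f : R -> R[i]^o) ->
  (Linf_norm f <= M%:E)%E -> cmod (f x) <= M.
Proof.
(* The norm of exponent [+oo] is the essential supremum only when the space has positive measure,
   seen here on [[0, 1]]. *)
move=> cf; rewrite /Linf_norm unlock ifT; last first.
  apply: (@lt_le_trans _ _ (mu (`[0, 1]%classic : set R))).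
    by rewrite lebesgue_measure_itv/= lte_fin ltr01 oppr0 adde0 lte_fin ltr01.
  by apply: le_measure => //; rewrite inE.
move=> /ess_supP [N [mN N0 fN]]; rewrite leNgt; apply/negP => fx.
have cm : continuous (cmod \o f : R -> R).
  by move=> y; exact: (cvg_comp _ _ (cf y) (@cmod_continuous R (f y))).
have /cvgrPdist_lt /(_ (cmod (f x) - M)) := cm x.
rewrite subr_gt0 => /(_ fx) [d /= d0 xd].
pose A : set R := `]x - d, x + d[%classic.
have : (mu A <= mu N)%E.
  apply: le_measure; rewrite ?inE//; first exact: measurable_itv.
  move=> y; rewrite /A /= in_itv/= -ltr_distl distrC => yx; apply: fN => /=.
  apply/negP; rewrite -ltNge lte_fin ger0_norm ?cmod_ge0//.
  have := xd y yx; rewrite ltr_distlC => /andP[+ _].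
  by rewrite opprB addrCA subrr addr0.
rewrite N0 /A lebesgue_measure_itv/= lte_fin ltrBlDr -addrA ltrDl addr_gt0//.
rewrite -EFinB lee_fin => h; have := d0; lra.
Qed.

Lemma Winf_norm_le k f (B : nat -> R) :
  (forall n x, (n <= k)%N -> cmod (cderiven n f x) <= B n) ->
  (Winf_norm k f <= (\sum_(n < k.+1) B n)%:E)%E.
Proof.
move=> fB; rewrite /Winf_norm -sumEFin; apply: lee_sum => n _.
by apply: Linf_norm_le => x; apply: fB; rewrite -ltnS.
Qed.

End Mollification.

(** * Mollification error *)

Section Taylor.
Set Implicit Arguments. Unset Strict Implicit.
Context {R : realType}.
Local Notation mu := (@lebesgue_measure R).
Local Notation Re := (@complex.Re R).
Local Notation Im := (@complex.Im R).
Implicit Types (f g phi : R -> R[i]) (c z w : R[i]).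

Lemma mean_value_bound (u u' : R -> R) (h B : R) :
  (forall t, is_derive t (1 : R) u (u' t)) ->
  (forall t, `|t| <= `|h| -> `|u' t| <= B) -> `|u h - u 0| <= B * `|h|.
Proof.
move=> du uB; have cu : continuous u.
  by apply: derivable_continuous => t; exact: ex_derive.
have [h0|h0] := leP 0 h.
  have [c cab ->] := MVT_segment h0 (fun t _ => du t) (continuous_subspaceT cu).
  rewrite subr0 normrM ler_wpM2r// uB//.
  by move: cab; rewrite in_itv/= => /andP[c0 ch]; rewrite !ger0_norm.
have [c cab e] := MVT_segment (ltW h0) (fun t _ => du t) (continuous_subspaceT cu).
rewrite distrC e sub0r normrM normrN ler_wpM2r// uB//.
move: cab; rewrite in_itv/= => /andP[c0 ch].
by rewrite !ler0_norm ?lerN2// ltW.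
Qed.

(** Induction on [m]: the derivative in [h] of the remainder is the remainder of the shifted
    sequence [F j.+1], and the mean value theorem adds one factor [|h|]. Taking the whole sequence
    of derivatives as data makes this shift available. The constant is [M] and not [M / m!], since
    each step uses only a uniform bound on the derivative. *)
Lemma taylor_bound m (F : nat -> R -> R) (M : R) :
  (forall j x, is_derive x (1 : R) (F j) (F j.+1 x)) ->
  (forall x, `|F m x| <= M) ->
  forall x h, `|F 0%N (x + h) - \sum_(j < m) F j x / j`!%:R * h ^+ j| <= M * `|h| ^+ m.
Proof.
elim: m F => [|m IH] F dF FM x h.
  by rewrite big_ord0 subr0 expr0 mulr1.
have M0 : 0 <= M by apply: le_trans (FM 0).
pose P : {poly R} := \poly_(j < m.+1) (F j x / j`!%:R).
have PE t : P.[t] = \sum_(j < m.+1) F j x / j`!%:R * t ^+ j by rewrite horner_poly.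
have P'E t : P^`().[t] = \sum_(j < m) F j.+1 x / j`!%:R * t ^+ j.
  have -> : P^`() = \poly_(j < m) (F j.+1 x / j`!%:R).
    apply/polyP => j; rewrite coef_deriv !coef_poly ltnS; case: ifP => _; last by rewrite mul0rn.
    have f0 : j`!%:R != 0 :> R by rewrite pnatr_eq0 -lt0n fact_gt0.
    have j0 : j.+1%:R != 0 :> R by rewrite pnatr_eq0.
    by rewrite -[LHS]mulr_natr factS natrM invfM mulrA mulrAC divfK.
  by rewrite horner_poly.
pose u t := F 0%N (x + t) - P.[t].
have du t : is_derive t (1 : R) u (F 1%N (x + t) - P^`().[t]).
  have dxt : is_derive t (1 : R) (fun s : R => x + s) 1.
    by have := is_deriveD (is_derive_cst x t 1) (is_derive_id t 1); rewrite add0r.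
  have := @is_derive1_comp R (F 0%N) (fun s : R => x + s) t _ _ (dF 0%N (x + t)) dxt.
  rewrite mulr1 => d1.
  exact: (is_deriveB d1 (is_derive_poly P t)).
have u0 : u 0 = 0.
  rewrite /u addr0 PE big_ord_recl big1 => [|i _].
    by rewrite fact0 divr1 expr0 mulr1 addr0 subrr.
  by rewrite /= expr0n/= mulr0.
have -> : F 0%N (x + h) - \sum_(j < m.+1) F j x / j`!%:R * h ^+ j = u h - u 0.
  by rewrite u0 subr0 /u PE.
rewrite exprSr mulrA; apply: (mean_value_bound du) => t th.
rewrite P'E; apply: le_trans (IH (fun j => F j.+1) (fun j => dF j.+1) FM x t) _.
by rewrite ler_wpM2l// lerXn2r.
Qed.

Lemma ctaylor_bound m f (M : R) : smooth f ->
  (forall x, cmod (cderiven m f x) <= M) ->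
  forall x h, cmod (f (x + h) -
     \sum_(j < m) (h ^+ j / j`!%:R)%:C * cderiven j f x) <= 2 * M * `|h| ^+ m.
Proof.
move=> sf fM x h.
have r := @taylor_bound m (fun j => Re \o cderiven j f) M.
have i := @taylor_bound m (fun j => Im \o cderiven j f) M.
have eR : Re (\sum_(j < m) (h ^+ j / j`!%:R)%:C * cderiven j f x) =
    \sum_(j < m) (Re \o cderiven j f) x / j`!%:R * h ^+ j.
  elim/big_ind2 : _ => // [z1 r1 z2 r2 <- <-|j _]; first by rewrite Defs.ReD.
  rewrite Defs.ReM /= mul0r subr0; ring.
have eI : Im (\sum_(j < m) (h ^+ j / j`!%:R)%:C * cderiven j f x) =
    \sum_(j < m) (Im \o cderiven j f) x / j`!%:R * h ^+ j.
  elim/big_ind2 : _ => // [z1 r1 z2 r2 <- <-|j _]; first by rewrite Defs.ImD.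
  rewrite Defs.ImM /= mul0r addr0; ring.
apply: le_trans (cmod_le_ReIm _) _; rewrite complexReB complexImB eR eI.
rewrite -mulrA mulr_natl mulr2n; apply: lerD.
  apply: r => [j y|y]; last exact: le_trans (ler_Re_cmod _) (fM y).
  by apply: DeriveDef; [exact: (sf j y).1|rewrite -derive1E].
apply: i => [j y|y]; last exact: le_trans (ler_Im_cmod _) (fM y).
by apply: DeriveDef; [exact: (sf j y).2|rewrite -derive1E].
Qed.

Lemma schwartz_moment m phi : schwartz phi ->
  cintegrable (fun y : R => (y ^+ m)%:C * phi y).
Proof.
move=> sphi; have [_ bphi] := sphi.
(* Decay of orders [m] and [m + 2] together bounds [|y|^m (1 + y^2) |phi y|]. *)
have [[A hA] [B hB]] := (bphi m 0%N, bphi m.+2 0%N).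
have iG := integrableZl measurableT (A + B) (@integrable_oneDsqrV R).
apply: (cintegrable_le _ iG) => [|y].
  apply: continuous_cmeasurable => y; apply: (@cvgM R[i]).
    apply/ccvgP; split; last exact: cvg_cst.
    by rewrite /=; exact: exprn_continuous.
  exact: (cderivable_ccontinuous (sphi.1 0%N)).
rewrite /= ler_pdivlMr ?(lt_le_trans ltr01 (oneDsqr_ge1 _))// /oneDsqr.
rewrite cmodM cmodC normrX mulrDr mulr1 lerD//.
apply: le_trans (hB y); rewrite -[y ^+ 2]ger0_norm ?sqr_ge0// normrX mulrAC.
by rewrite -exprD addn2.
Qed.

Lemma cintegral_sum n (u : nat -> R -> R[i]) : (forall j, cintegrable (u j)) ->
  cintegrable (fun x => \sum_(j < n) u j x) /\
  cintegral (fun x => \sum_(j < n) u j x) = \sum_(j < n) cintegral (u j).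
Proof.
move=> iu; elim: n => [|n [IH1 IH2]].
  rewrite big_ord0 (_ : (fun x => _) = 0); last by apply/funext => x; rewrite big_ord0.
  by split; [exact: cintegrable0|exact: cintegral0].
have [h1 h2] := cintegral_lin 1 IH1 (iu n).
rewrite (_ : (fun x => _) = 1 *: (fun x => \sum_(j < n) u j x) + u n); last first.
  by apply/funext => x; rewrite big_ord_recr/= !fctE scale1r.
by split=> //; rewrite h2 mul1r IH2 big_ord_recr.
Qed.

(** Integrating the Taylor polynomial of order below [m] against [rho] returns exactly [f x]: its
    constant term, present because [0 < m], has weight 1, and the others are killed by the moments.
    Only the remainder is left, of size [|e y|^m]. *)
Lemma mollify_error m f (rho : R -> R[i]) (M e : R) x : 0 < e ->
  (0 < m)%N -> smooth f -> Cb f -> (forall x, cmod (cderiven m f x) <= M) ->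
  schwartz rho -> cintegral rho = 1 ->
  (forall k : nat, (0 < k)%N -> cintegral (fun x : R => (x ^+ k)%:C * rho x) = 0) ->
  cmod (convol f (mollifier rho e) x - f x) <=
  2 * (2 * M * \int[mu]_y cmod ((y ^+ m)%:C * rho y)) * e ^+ m.
Proof.
move=> e0 m0 sf bf fM srho rho1 rhok.
have [ic] := convol_mollifier 0 x e0 bf srho.
rewrite expr0 invr1 mul1r => -> /=.
pose a j := ((- e) ^+ j / j`!%:R)%:C * cderiven j f x.
pose u j y := a j * ((y ^+ j)%:C * rho y).
have iu j : cintegrable (u j).
  have [] := cintegral_lin (a j) (schwartz_moment j srho) (@cintegrable0 R).
  by rewrite addr0.
have eu j : cintegral (u j) = a j * cintegral (fun y : R => (y ^+ j)%:C * rho y).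
  have [_] := cintegral_lin (a j) (schwartz_moment j srho) (@cintegrable0 R).
  by rewrite cintegral0 !addr0.
have [isum esum] := cintegral_sum m iu.
(* The normalization and the vanishing moments of [rho] are used here. *)
have fx : f x = cintegral (fun y => \sum_(j < m) u j y).
  rewrite esum; case: m m0 {fM isum esum} => // m _.
  rewrite big_ord_recl big1 => [|j _]; last by rewrite eu rhok// mulr0.
  rewrite eu addr0 /a /= expr0 fact0 divr1 mul1r.
  rewrite (_ : (fun y => _) = rho) ?rho1 ?mulr1//.
  by apply/funext => y; rewrite expr0 mul1r.
have [i1 e1] := cintegral_lin (-1) isum ic.
rewrite fx addrC -mulN1r -e1.
have im := integrable_cmod (schwartz_moment m srho).
have iG := integrableZl measurableT (2 * M * e ^+ m) im.
apply: le_trans (cmod_cintegral_le i1 iG _) _ => [y|]; last first.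
  rewrite RintegralZl//= le_eqVlt; apply/orP; left; apply/eqP; ring.
rewrite !fctE scaleN1r addrC /u.
have -> : f (x - e * y) * cderiven 0 rho y - \sum_(j < m) a j * ((y ^+ j)%:C * rho y) =
   (f (x + - e * y) - \sum_(j < m) ((- e * y) ^+ j / j`!%:R)%:C * cderiven j f x) * rho y.
  rewrite mulrBl mulNr; congr (_ - _); rewrite mulr_suml; apply: eq_bigr => j _.
  rewrite /a -mulNr exprMn !rmorphM /=; ring.
rewrite cmodM; apply: le_trans (ler_wpM2r (cmod_ge0 _) (ctaylor_bound sf fM x _)) _.
rewrite /= cmodM cmodC normrM normrN (gtr0_norm e0) exprMn normrX le_eqVlt; apply/orP; left; apply/eqP; ring.
Qed.

End Taylor.

(** * The maps into the algebra of generalized functions *)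

Section Nets.
Set Implicit Arguments. Unset Strict Implicit.
Context {R : realType}.
Local Notation mu := (@lebesgue_measure R).
Implicit Types (f g phi : R -> R[i]) (c z w : R[i]).

Lemma cintegral_by_parts_iter j g (phi : R -> R[i]) : smooth g ->
  (forall k, Cb (cderiven k g)) -> is_DL1 phi ->
  cintegral (fun x => cderiven j g x * phi x) =
  (-1) ^+ j * cintegral (fun x => g x * cderiven j phi x).
Proof.
move=> sg bg; elim: j phi => [|j IH] phi dphi; first by rewrite expr0 mul1r.
have dphi' : is_DL1 (cderive phi).
  case: dphi => sphi iphi; split; first exact: smooth_cderive.
  by move=> n; rewrite cderivenS.
have := cintegral_by_parts (bg j) (sg j) (bg j.+1) dphi.
rewrite IH// => /esym/eqP; rewrite eqr_oppLR => /eqP e; rewrite [LHS]e.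
by rewrite exprS mulN1r mulNr cderivenS.
Qed.

(** A sequence in the index set ]0, 1] along which eps tends to 0. *)
Definition eps_seq (n : nat) : R := n.+1%:R^-1.

Lemma eps_seq_itv n : 0 < eps_seq n <= 1.
Proof. by rewrite invr_gt0 ltr0n/= invf_le1 ?ltr0n// ler1n. Qed.

Lemma eps_seq_gt0 n : 0 < eps_seq n.
Proof. by case/andP: (eps_seq_itv n). Qed.

Lemma eps_seq_cvg : eps_seq n @[n --> \oo] --> (0 : R).
Proof. exact: cvg_harmonic. Qed.

Lemma convol_mollifier_cvg f (rho : R -> R[i]) x : Cb f -> schwartz rho ->
  cintegral rho = 1 ->
  (convol f (mollifier rho (eps_seq n)) x : R[i]^o) @[n --> \oo] --> (f x : R[i]^o).
Proof.
move=> bf srho rho1; have irho := schwartz_cintegrable srho.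
have [cf [M fM]] := bf.
have key n := convol_mollifier 0 x (eps_seq_gt0 n) bf srho.
under eq_fun => n.
  have [_] := key n; rewrite expr0 invr1 mul1r /= => ->; over.
have [_ e1] := cintegral_lin (f x) irho (@cintegrable0 R).
rewrite cintegral0 rho1 mulr1 !addr0 in e1; rewrite -[f x]e1.
have iG := integrableZl measurableT M (integrable_cmod irho).
apply: (@dominated_cintegral_cvg R (fun n y => f (x - eps_seq n * y) * rho y) _ _ _ _ iG _).2.
- by move=> n; exact: cintegrable_cmeasurable (key n).1.
- move=> y; apply: (@cvgMr_tmp R[i]).
  have h : x - eps_seq n * y @[n --> \oo] --> x - 0 * y.
    by apply: cvgB; [exact: cvg_cst|apply: cvgMr_tmp; exact: eps_seq_cvg].
  rewrite mul0r subr0 in h; exact: (cvg_comp _ _ h (cf x)).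
- by move=> n y; rewrite cmodM ler_wpM2r ?cmod_ge0.
Qed.

Lemma cintegral_convol_cvg f (rho psi : R -> R[i]) : Cb f -> schwartz rho ->
  cintegral rho = 1 -> cintegrable psi ->
  (cintegral (fun x => convol f (mollifier rho (eps_seq n)) x * psi x) : R[i]^o)
    @[n --> \oo] --> (cintegral (fun x => f x * psi x) : R[i]^o).
Proof.
move=> bf srho rho1 ipsi; have [_ [M fM]] := bf.
have iG := integrableZl measurableT (2 * (M * \int[mu]_y cmod (cderiven 0 rho y))) (integrable_cmod ipsi).
apply: (@dominated_cintegral_cvg R
  (fun n x => convol f (mollifier rho (eps_seq n)) x * psi x) _ _ _ _ iG _).2.
- move=> n; apply/cintegrable_cmeasurable/Cb_cintegrable => //.
  exact: (Cb_convol bf (schwartz_mollifier (eps_seq_gt0 n) srho)).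
- by move=> y; apply: (@cvgMr_tmp R[i]); exact: convol_mollifier_cvg.
- move=> n x; rewrite cmodM ler_wpM2r ?cmod_ge0//.
  have := convol_mollifier_bound 0 x (eps_seq_gt0 n) bf fM srho.
  by rewrite expr0 invr1 mulr1.
Qed.

(** Padding by zero beyond [k] removes the side condition on [j], so that the functions [f j] can be
    used as a total family. *)
Lemma Bpaaa_decomposition (T : DL1 R -> R[i]) : is_Bpaaa T ->
  exists k (f : nat -> R -> R[i]), (forall j, Caaa (f j)) /\
    T = \sum_(j < k.+1) iter j (@dist_deriv R) (dist_of (f j)).
Proof.
move=> [_ [k [f [cf ->]]]].
exists k, (fun j => if (j <= k)%N then f j else 0); split=> [j|].
  by case: ifPn => [/cf//|_]; exact: Caaa0.
by apply: eq_bigr => j _; rewrite -ltnS ltn_ord.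
Qed.

Lemma dist_conv_sum k (f : nat -> R -> R[i]) phi (sphi : schwartz phi) :
  (forall j, Caaa (f j)) ->
  dist_conv (\sum_(j < k) iter j (@dist_deriv R) (dist_of (f j))) sphi =
  \sum_(j < k) convol (f j) (cderiven j phi).
Proof.
move=> cf; apply/funext => x; rewrite /dist_conv !fct_sumE; apply: eq_bigr => j _.
by rewrite -(dist_conv_dist_deriv j sphi (cf j).1).
Qed.

Lemma Baaa_convol f phi : Caaa f -> schwartz phi -> is_Baaa (convol f phi).
Proof.
move=> cf sphi; split=> [|n]; first exact: smooth_convol cf.1 sphi.
by rewrite (cderiven_convol n cf.1 sphi).2; apply: Caaa_convol => //; exact: schwartz_cderiven.
Qed.

Lemma Baaa_sum k (f : nat -> R -> R[i]) : (forall j, is_Baaa (f j)) ->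
  is_Baaa (\sum_(j < k) f j).
Proof.
move=> bf; elim/big_ind : _ => //; first exact: Baaa0.
by move=> u v bu bv; rewrite -[u]scale1r; exact: Baaa_lin.
Qed.

Lemma Baaa_dist_conv (T : DL1 R -> R[i]) phi (sphi : schwartz phi) :
  is_Bpaaa T -> is_Baaa (dist_conv T sphi).
Proof.
move=> /Bpaaa_decomposition[k [f [cf ->]]]; rewrite dist_conv_sum//.
apply: (@Baaa_sum _ (fun j => convol (f j) (cderiven j phi))) => j.
by apply: Baaa_convol => //; exact: schwartz_cderiven.
Qed.

Lemma Baaa_mem f : is_Baaa f -> f \in @Baaa_pred R.
Proof. by move=> bf; apply/asboolP. Qed.

Section Net.
Context (rho : R -> R[i]) (srho : schwartz rho).

(** The contribution of one summand [f^(j)] of a distribution to its regularization. *)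
Definition derivative_net f (cf : Caaa f) j : epsI R -> Baaa R := fun e =>
  MkBaaa (Baaa_mem (Baaa_convol cf
    (schwartz_cderiven j (schwartz_mollifier (epsI_gt0 e) srho)))).

Lemma moderate_derivative_net f (cf : Caaa f) j : moderate (derivative_net cf j).
Proof.
(* The seminorm involves at most [k] derivatives beyond the [j] already on the mollifier, and as eps
   is at most 1 the worst power is [eps^-(k + j)]. *)
move=> k; exists (k + j)%N; have [bf _] := cf; have [_ [M fM]] := bf.
pose A n := 2 * (M * \int[mu]_y cmod (cderiven (n + j) rho y)).
have M0 : 0 <= M by apply: le_trans (fM 0); exact: cmod_ge0.
have A0 n : 0 <= A n.
  by rewrite !mulr_ge0// Rintegral_ge0// => y _; exact: cmod_ge0.
exists (\sum_(n < k.+1) A n), 1; split=> // e _.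
have e0 := epsI_gt0 e; have e1 := epsI_le1 e.
rewrite mulr_suml; apply: (@Winf_norm_le R k _ (fun n => A n * (val e) ^- (k + j))).
move=> n x nk; rewrite /derivative_net /=.
have s := schwartz_cderiven j (schwartz_mollifier e0 srho).
rewrite (cderiven_convol n bf s).2 /cderiven -iterD.
apply: le_trans (convol_mollifier_bound (n + j) x e0 bf fM srho) _.
apply: (ler_wpM2l (A0 n)); rewrite lef_pV2 ?posrE ?exprn_gt0//.
by rewrite ler_wiXn2l ?(ltW e0)// leq_add2r.
Qed.

Definition regularization (T : Bpaaa R) : epsI R -> Baaa R := fun e =>
  MkBaaa (Baaa_mem (Baaa_dist_conv (schwartz_mollifier (epsI_gt0 e) srho) (BpaaaP T))).

Lemma moderate_regularization T : moderate (regularization T).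
Proof.
have [k [f [cf eT]]] := Bpaaa_decomposition (BpaaaP T).
have -> : regularization T = \sum_(j < k.+1) derivative_net (cf j) j.
  apply/funext => e; apply: val_inj => /=.
  rewrite eT dist_conv_sum// [in RHS]fct_sumE.
  by rewrite (big_morph (@Baaa_fun R) (id1 := 0) (op1 := +%R)).
elim/big_ind : _ => [|u v mu mv|j _].
- exact: moderate0.
- by rewrite -[u]scale1r; exact: moderate_lin.
- exact: moderate_derivative_net.
Qed.

Lemma Maaa_mem (u : epsI R -> Baaa R) : moderate u -> u \in @Maaa_pred R.
Proof. by move=> mu; apply/asboolP. Qed.

Definition regularizationM T : Maaa R := MkMaaa (Maaa_mem (moderate_regularization T)).

Definition iota_aaa (T : Bpaaa R) : Gaaa R := Gaaa_class (regularizationM T).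

Lemma iota_aaa_is_linear : linear iota_aaa.
Proof.
move=> a T S; rewrite /iota_aaa -linearP; congr Gaaa_class.
by apply: val_inj; apply/funext => e; apply: val_inj.
Qed.
HB.instance Definition _ :=
  GRing.isLinear.Build R[i] (Bpaaa R) (Gaaa R) _ iota_aaa iota_aaa_is_linear.

End Net.

Lemma Baaa_bounded (f : Baaa R) : exists B : nat -> R,
  forall n x, cmod (cderiven n f x) <= B n.
Proof.
have [_ cf] := BaaaP f.
have /choice[B hB] : forall n, exists M : R, forall x, cmod (cderiven n f x) <= M.
  by move=> n; have [[_ [M fM]] _] := cf n; exists M.
by exists B.
Qed.

Lemma moderate_cst (f : Baaa R) : moderate (fun=> f).
Proof.
move=> k; exists 0%N; have [B hB] := Baaa_bounded f.
exists (\sum_(n < k.+1) B n), 1; split=> // e _.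
by rewrite expr0 invr1 mulr1; apply: Winf_norm_le => n x _; exact: hB.
Qed.

Definition constantM (f : Baaa R) : Maaa R := MkMaaa (Maaa_mem (moderate_cst f)).

Definition sigma_aaa (f : Baaa R) : Gaaa R := Gaaa_class (constantM f).

Lemma sigma_aaa_is_linear : linear sigma_aaa.
Proof.
move=> a f g; rewrite /sigma_aaa -linearP; congr Gaaa_class.
exact: val_inj.
Qed.
HB.instance Definition _ :=
  GRing.isLinear.Build R[i] (Baaa R) (Gaaa R) _ sigma_aaa sigma_aaa_is_linear.

End Nets.

(** * Functions as distributions *)

Section DistributionEmbedding.
Set Implicit Arguments. Unset Strict Implicit.
Context {R : realType}.
Local Notation mu := (@lebesgue_measure R).
Implicit Types (f g phi : R -> R[i]) (c z w : R[i]).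

Lemma bounded_distribution_dist_of f : Cb f -> bounded_distribution (dist_of f).
Proof.
move=> bf; have [_ [M fM]] := bf.
have iphi (phi : DL1 R) : cintegrable phi by have [_ /(_ 0%N)] := DL1P phi.
have lf : linear (dist_of f).
  move=> a phi psi.
  apply: etrans (cintegral_lin a (Cb_cintegrable bf (iphi phi)) (Cb_cintegrable bf (iphi psi))).2.
  rewrite /dist_of; congr cintegral; apply/funext => x.
  by rewrite -[(a *: phi + psi) x]/(a * phi x + psi x) mulrDr mulrCA.
have M0 : 0 <= M by apply: le_trans (fM 0); exact: cmod_ge0.
(* The [L^1] seminorm alone suffices. The 2 is the loss in [cmod_cintegral_le]; the added 1 keeps
   the denominator positive when [M] is 0. *)
split=> // phi0 e e0; exists 0%N, (e / (2 * M + 1)).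
have d0 : 0 < 2 * M + 1 by rewrite ltr_wpDl// mulr_ge0.
split=> [|phi]; first by rewrite divr_gt0.
rewrite /W1_norm big_ord1 Lnorm1 => h.
have {h} h : \int[mu]_x cmod ((phi - phi0) x) < e / (2 * M + 1).
  have := integrable_fin_num measurableT (integrable_cmod (iphi (phi - phi0))).
  rewrite -lte_fin => /fineK ->; apply: le_lt_trans h.
  rewrite le_eqVlt; apply/orP; left; apply/eqP; apply: eq_integral => x _ /=.
  by rewrite ger0_norm ?cmod_ge0.
have -> : dist_of f phi - dist_of f phi0 = dist_of f (phi - phi0).
  by have := lf (-1) phi0 phi; rewrite !scaleN1r [- phi0 + phi]addrC => ->; rewrite addrC.
have iG := integrableZl measurableT M (integrable_cmod (iphi (phi - phi0))).
apply: le_lt_trans (cmod_cintegral_le (Cb_cintegrable bf (iphi _)) iG _) _.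
  by move=> x; rewrite cmodM ler_wpM2r ?cmod_ge0.
rewrite RintegralZl//; last exact: (integrable_cmod (iphi (phi - phi0))).
move: h; rewrite ltr_pdivlMr// => h; apply: le_lt_trans h.
set I := Rintegral _ _ _.
have I0 : 0 <= I by apply: Rintegral_ge0 => x _; exact: cmod_ge0.
by rewrite mulrA mulrC ler_wpM2l// lerDl.
Qed.

Lemma Bpaaa_dist_of (f : Baaa R) : dist_of f \in @Bpaaa_pred R.
Proof.
apply/asboolP; have [_ cf] := BaaaP f; split.
  exact: (bounded_distribution_dist_of (cf 0%N).1).
exists 0%N, (fun=> f : R -> R[i]); split; first by move=> j _; exact: (cf 0%N).
by rewrite big_ord1.
Qed.

Definition gamma_aaa (f : Baaa R) : Bpaaa R := MkBpaaa (Bpaaa_dist_of f).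

Lemma gamma_aaa_is_linear : linear gamma_aaa.
Proof.
move=> a f g; apply: val_inj.
have [[_ cf] [_ cg]] := (BaaaP f, BaaaP g).
exact: (dist_of_lin a (cf 0%N).1 (cg 0%N).1).
Qed.
HB.instance Definition _ :=
  GRing.isLinear.Build R[i] (Baaa R) (Bpaaa R) _ gamma_aaa gamma_aaa_is_linear.

End DistributionEmbedding.

(** * Injectivity and commutativity *)

Section Diagram.
Set Implicit Arguments. Unset Strict Implicit.
Context {R : realType}.
Local Notation mu := (@lebesgue_measure R).
Implicit Types (f g phi : R -> R[i]) (c z w : R[i]).

Lemma Gaaa_class_eq0 (u : Maaa R) : Gaaa_class u = 0 -> Defs.negligible u.
Proof.
move=> u0; have e0 : Gaaa_class (0 : Maaa R) = 0 by exact: raddf0.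
by have /Gaaa_classP := etrans u0 (esym e0); rewrite subr0.
Qed.

Definition eps_net n : epsI R := exist _ (eps_seq n) (eps_seq_itv n).

(** Negligibility at order 0 and exponent 1, read along [eps_seq]. The members of the net are
    continuous, so the essential supremum bounds every value. *)
Lemma negligible_near (u : epsI R -> Baaa R) : Defs.negligible u ->
  exists c : R, \forall n \near \oo, forall x, cmod (u (eps_net n) x) <= c * eps_seq n.
Proof.
move=> nu; have [c [eta [eta0 uc]]] := nu 0%N 1%N; exists c.
near=> n => x.
have /uc : val (eps_net n) < eta.
  by near: n; exact: (cvgr_lt _ (@eps_seq_cvg R)).
rewrite /Winf_norm big_ord1 expr1; apply: Linf_norm_ge.
by apply: cderivable_ccontinuous => y; have [su _] := BaaaP (u (eps_net n)); exact: (su 0%N).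
Unshelve. all: end_near. Qed.

Lemma cvg_mul_eps_seq (c : R) : c * eps_seq n @[n --> \oo] --> (0 : R).
Proof. by rewrite -[X in _ --> X](mulr0 c); apply: cvgMl_tmp; exact: eps_seq_cvg. Qed.

Lemma sigma_aaa_inj : injective (@sigma_aaa R).
Proof.
apply: (raddf_inj (f := @sigma_aaa R)) => f /Gaaa_class_eq0/negligible_near[c fc].
apply: val_inj; apply/funext => x; apply: cmod_eq0; apply/eqP.
rewrite eq_le cmod_ge0 andbT.
apply: (cvgr_to_ge (cvg_mul_eps_seq c)).
by near=> n; move: x; near: n.
Unshelve. all: end_near. Qed.

(** * Injectivity of regularization and comparison with constant nets *)

Section Iota.
Context (rho : R -> R[i]) (srho : schwartz rho).
Context (rho1 : cintegral rho = 1).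

(* Only distributional derivatives of [f j * rho_eps] appear in [T * rho_eps], so
   an integration by parts replaces any density or Fubini argument. *)
Lemma regularization_cvg (T : Bpaaa R) (phi : DL1 R) :
  (cintegral (fun x => regularization srho T (eps_net n) x * phi x) : R[i]^o)
    @[n --> \oo] --> (T phi : R[i]^o).
Proof.
have [k [f [cf eT]]] := Bpaaa_decomposition (BpaaaP T).
have [sphi iphi] := DL1P phi.
pose m n := mollifier rho (eps_seq n).
have sm n : schwartz (m n) := schwartz_mollifier (eps_seq_gt0 n) srho.
have eTphi : T phi = \sum_(j < k.+1) (-1) ^+ j * cintegral (fun x => f j x * cderiven j phi x).
  rewrite eT fct_sumE; apply: eq_bigr => j _.
  by rewrite iter_dist_derivE /dist_of iter_DL1_derivE.
have eS n : cintegral (fun x => regularization srho T (eps_net n) x * phi x) =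
    \sum_(j < k.+1) (-1) ^+ j * cintegral (fun x => convol (f j) (m n) x * cderiven j phi x).
  pose u j x := cderiven j (convol (f j) (m n)) x * phi x.
  have bu j i : Cb (cderiven i (convol (f j) (m n))).
    rewrite (cderiven_convol i (cf j).1 (sm n)).2.
    exact: (Cb_convol (cf j).1 (schwartz_cderiven i (sm n))).
  have iu j : cintegrable (u j) by exact: (Cb_cintegrable (bu j j) (iphi 0%N)).
  transitivity (cintegral (fun x => \sum_(j < k.+1) u j x)).
    congr cintegral; apply/funext => x /=; rewrite eT dist_conv_sum// fct_sumE mulr_suml.
    by apply: eq_bigr => j _; rewrite /u (cderiven_convol j (cf j).1 (sm n)).2.
  rewrite (cintegral_sum k.+1 iu).2; apply: eq_bigr => j _.
  exact: (cintegral_by_parts_iter j (smooth_convol (cf j).1 (sm n)) (bu j) (DL1P phi)).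
under eq_fun do rewrite eS; rewrite eTphi.
(* All derivatives now sit on the fixed [phi], so each of the finitely many terms converges by
   itself. *)
apply: (cvg_big (x0 := 0 : R[i]^o) (op := +%R)) => [|j _]; first exact: add_continuous.
apply: (@cvgMl_tmp R[i]).
exact: (cintegral_convol_cvg (cf j).1 srho rho1 (iphi j)).
Qed.

Lemma iota_aaa_inj : injective (iota_aaa srho).
Proof.
apply: (raddf_inj (f := iota_aaa srho)) => T /Gaaa_class_eq0/negligible_near[c uc].
apply: val_inj; apply/funext => phi; apply: cmod_eq0; apply/eqP.
rewrite eq_le cmod_ge0 andbT.
have [sphi iphi] := DL1P phi.
have cv := cvg_comp _ _ (@regularization_cvg T phi) (@cmod_continuous R (T phi)).
(* [c * eps] bounds the regularization uniformly in [x], and 2 is the loss in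
   [cmod_cintegral_le]. *)
have c0 := cvg_mul_eps_seq (2 * c * \int[mu]_x cmod (phi x)).
apply: (ler_cvg_to cv c0); near=> n => /=.
have ub : forall x, cmod (regularization srho T (eps_net n) x) <= c * eps_seq n.
  by near: n.
have iu : cintegrable (fun x => regularization srho T (eps_net n) x * phi x).
  apply: Cb_cintegrable (iphi 0%N).
  by have [_ /(_ 0%N) []] := BaaaP (regularization srho T (eps_net n)).
have iG := integrableZl measurableT (c * eps_seq n) (integrable_cmod (iphi 0%N)).
apply: le_trans (cmod_cintegral_le iu iG _) _ => [x|].
  by rewrite cmodM ler_wpM2r ?cmod_ge0.
rewrite RintegralZl//; last exact: (integrable_cmod (iphi 0%N)).
by rewrite /= le_eqVlt; apply/orP; left; apply/eqP; ring.
Unshelve. all: end_near. Qed.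

Context (rho_moments : forall k : nat, (0 < k)%N ->
  cintegral (fun x : R => (x ^+ k)%:C * rho x) = 0).

Lemma iota_gamma (f : Baaa R) : iota_aaa srho (@gamma_aaa R f) = @sigma_aaa R f.
Proof.
apply/Gaaa_classP => k m.
have [sf cf] := BaaaP f; have [B fB] := Baaa_bounded f.
(* Taylor order [m + 1] is used for the exponent [m]: it is positive even for [m = 0], as
   [mollify_error] requires, and [eps^(m + 1) <= eps^m]. Applied to the [n]-th derivative of [f], it
   calls for the bound [B] of order [m + 1 + n]. *)
pose I := \int[mu]_y cmod ((y ^+ m.+1)%:C * rho y).
pose C n := 2 * (2 * B (m.+1 + n)%N * I).
exists (\sum_(n < k.+1) C n), 1; split=> // e _.
have e0 := epsI_gt0 e; have e1 := epsI_le1 e.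
have se := schwartz_mollifier e0 srho.
have bf n : Cb (cderiven n f) by case: (cf n).
rewrite mulr_suml; apply: (@Winf_norm_le R k _ (fun n => C n * val e ^+ m)) => n x _.
have -> : Baaa_fun ((regularizationM srho (@gamma_aaa R f) - constantM f : Maaa R) e) =
    (-1) *: (f : R -> R[i]) + convol f (mollifier rho (val e)).
  rewrite scaleN1r [RHS]addrC.
  rewrite -[RHS]/(convol f (mollifier rho (val e)) - f).
  by rewrite -(dist_conv_dist_deriv 0 se (bf 0%N)).
rewrite cderivenP//; last exact: (smooth_convol (bf 0%N) se).
rewrite (cderiven_convol n (bf 0%N) se).2 scaleN1r addrC.
rewrite [convol _ _](convol_cderiven n sf bf se).
have I0 : 0 <= I by apply: Rintegral_ge0 => y _; exact: cmod_ge0.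
have B0 j : 0 <= B j by apply: le_trans (fB j 0); exact: cmod_ge0.
have sfn : smooth (cderiven n f) by move=> j y; rewrite /cderiven -iterD; exact: sf.
have fBn y : cmod (cderiven m.+1 (cderiven n f) y) <= B (m.+1 + n)%N.
  by have := fB (m.+1 + n)%N y; rewrite {1}/cderiven iterD.
apply: le_trans (mollify_error x e0 (ltn0Sn m) sfn (bf n) fBn srho rho1 rho_moments) _.
apply: ler_wpM2l; first by rewrite /C !mulr_ge0.
by rewrite ler_wiXn2l// ltW.
Qed.

End Iota.
End Diagram.

(** Linearity and the target spaces are carried by the types. Well-definedness of [iota] and [sigma]
    is expressed by a moderate representative with prescribed values; these values determine the
    class, so the three existentially quantified maps are the intended ones. *)
Theorem proposition4 (R : realType) (rho : R -> R[i]) (rhoS : schwartz rho)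
    (rho_int : cintegral rho = 1)
    (rho_moments : forall k : nat, (0 < k)%N ->
      cintegral (fun x : R => (x ^+ k)%:C * rho x) = 0) :
  exists (iota : {linear Bpaaa R -> Gaaa R})
         (sigma : {linear Baaa R -> Gaaa R})
         (gamma : {linear Baaa R -> Bpaaa R}),
    (forall T : Bpaaa R, exists u : Maaa R,
       (forall (eps : epsI R) (x : R),
          u eps x = dist_conv T (schwartz_mollifier (epsI_gt0 eps) rhoS) x) /\
       iota T = Gaaa_class u) /\
    (forall f : Baaa R, exists u : Maaa R,
       (forall eps : epsI R, u eps = f) /\ sigma f = Gaaa_class u) /\
    (forall (f : Baaa R) (phi : DL1 R), gamma f phi = dist_of f phi) /\
    injective iota /\ injective sigma /\ injective gamma /\
    (forall f : Baaa R, iota (gamma f) = sigma f).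
Proof.
exists (iota_aaa rhoS), (@sigma_aaa R), (@gamma_aaa R).
have ig := iota_gamma rhoS rho_int rho_moments.
split; first by move=> T; exists (regularizationM rhoS T).
split; first by move=> f; exists (constantM f).
split=> //; split; first exact: iota_aaa_inj.
split; first exact: sigma_aaa_inj.
split=> // f g fg; apply: sigma_aaa_inj.
by rewrite -!ig fg.
Qed.
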